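(* Let $c>0$ be a constant and let $G\in\mathcal{G}(n,p)$ with $p=\frac{c}{n}$. Then: (1) if $c<1$, then a.a.s. $\operatorname{td}(G)=\Theta(\log\log n)$; (2) if $c=1$, then a.a.s. $\operatorname{td}(G)=\Theta(\log n)$; (3) if $c>1$, then a.a.s. $\operatorname{td}(G)=\Theta(n)$. Here ''a.a.s. $\operatorname{td}(G)=\Theta(f(n))$'' means that there are constants $0<a\le b$, depending only on $c$, such that $\Pr\left(a f(n)\le \operatorname{td}(G)\le b f(n)\right)\to 1$ as $n\to\infty$.
   Context: All graphs are finite and simple. $\mathcal{G}(n,p)$ is the Erdős–Rényi random graph on $n$ labeled vertices in which each pair of vertices is an edge independently with probability $p$. A property holds asymptotically almost surely (a.a.s.) if its probability tends to $1$ as $n\to\infty$. The symbol $\log$ denotes the logarithm in base $2$. Tree-depth: the closure of a rooted tree $T$ is the graph on the vertex set of $T$ in which two distinct vertices are adjacent iff one is an ancestor of the other in $T$. A rooted forest is a disjoint union of rooted trees, and its closure is the disjoint union of the closures of its trees. The height of a rooted tree is the maximum number of vertices on a path from the root to a vertex, and the height of a rooted forest is the maximum height of its trees. The tree-depth $\operatorname{td}(G)$ of a graph $G$ is the minimum height of a rooted forest $F$ on the vertex set $V(G)$ such that $G$ is a subgraph of the closure of $F$. (With this convention $\operatorname{td}(K_n)=n$.) *)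

(* Defs.v *)
From HB Require Import structures.
From mathcomp Require Import all_boot all_order all_algebra.
From mathcomp Require Import all_classical all_reals all_analysis.
Import Order.TTheory GRing.Theory Num.Theory.
Import numFieldNormedType.Exports.

Set Implicit Arguments.
Unset Strict Implicit.
Unset Printing Implicit Defensive.

Local Open Scope set_scope.

Definition vpairs (T : finType) : {set {set T}} :=
  [set e : {set T} | #|e| == 2].

Record sgraph (T : finType) := SGraph {
  edges :> {set {set T}};
  edgesP : edges \subset vpairs T }.

HB.instance Definition _ (T : finType) := [isSub for @edges T].
HB.instance Definition _ (T : finType) := [Finite of sgraph T by <:].

(* A rooted forest on the vertex set T is encoded by its parent function:
   [F x = None] when x is a root.  Every vertex must reach a root, which
   excludes cycles of the parent function. *)
Definition parent_rel (T : finType) (F : {ffun T -> option T}) : rel T :=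
  [rel x y | F x == Some y].

(* Reflexive: every vertex is an ancestor of itself. *)
Definition ancestor (T : finType) (F : {ffun T -> option T}) (y x : T) : bool :=
  connect (parent_rel F) x y.

Definition rooted_forest (T : finType) (F : {ffun T -> option T}) : bool :=
  [forall x, exists r, (F r == None) && ancestor F r x].

Definition forest_closure (T : finType) (F : {ffun T -> option T}) :
    {set {set T}} :=
  [set [set x; y] | x in T, y in T & (x != y) && ancestor F x y].

(* The vertices on the path from the root to x are the ancestors of x. *)
Definition forest_height (T : finType) (F : {ffun T -> option T}) : nat :=
  \max_(x : T) #|[set y | ancestor F y x]|.

Definition has_forest_of_height (T : finType) (G : sgraph T) (h : nat) : bool :=
  [exists F : {ffun T -> option T},
     [&& rooted_forest F, edges G \subset forest_closure F
       & forest_height F == h]].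

(* The witness is a path through all the vertices, whose closure is complete. *)
Lemma has_forest_of_height_ex (T : finType) (G : sgraph T) :
  exists h, has_forest_of_height G h.
Proof.
pose F : {ffun T -> option T} :=
  [ffun x => if enum_rank x : nat is k.+1 then Some (nth x (enum T) k) else None].
have anc x y : enum_rank y <= enum_rank x -> ancestor F y x.
  have [k] := ubnP (enum_rank x); elim: k x => // k IHk x ltk.
  rewrite leq_eqVlt => /predU1P[/val_inj/enum_rank_inj-> | lt_yx].
    exact: connect0.
  have lt_x : enum_rank x < size (enum T) by rewrite -cardE ltn_ord.
  case def_x: (enum_rank x : nat) => [|j]; first by rewrite def_x in lt_yx.
  have lt_j : j < #|T| by rewrite def_x -cardE in lt_x; apply: ltnW.
  have Fx : F x = Some (enum_val (Ordinal lt_j)).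
    by rewrite ffunE def_x; congr Some; apply: set_nth_default; rewrite -cardE.
  apply: (@connect_trans _ _ (enum_val (Ordinal lt_j))).
    by apply: connect1; rewrite /parent_rel /= Fx.
  by apply: IHk; rewrite enum_valK /=; [move: ltk | move: lt_yx]; rewrite def_x.
exists (forest_height F); apply/existsP; exists F; rewrite eqxx andbT.
apply/andP; split.
  apply/forallP => x; apply/existsP.
  have T_gt0 : 0 < #|T| by apply/card_gt0P; exists x.
  exists (enum_val (Ordinal T_gt0)).
  by rewrite ffunE enum_valK /= anc // enum_valK.
apply/fintype.subsetP => e /(fintype.subsetP (edgesP G)); rewrite inE => /cards2P[x [y [nxy ->]]].
have [le_xy|lt_yx] := leqP (enum_rank x) (enum_rank y).
  by apply/imset2P; exists x y; rewrite ?inE ?nxy ?anc.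
rewrite finset.setUC; apply/imset2P; exists y x; rewrite ?inE ?anc ?andbT //.
- by rewrite eq_sym.
- exact: ltnW.
Qed.

Definition treedepth (T : finType) (G : sgraph T) : nat :=
  ex_minn (has_forest_of_height_ex G).

Local Open Scope ring_scope.

(* Probability of the event A in the random graph G(n,p), for 0 <= p <= 1. *)
Definition Gnp_prob (R : realType) (n : nat) (p : R) (A : pred (sgraph 'I_n)) : R :=
  \sum_(G : sgraph 'I_n | A G)
    \prod_(e in vpairs 'I_n) (if e \in edges G then p else 1 - p).

Definition log2 (R : realType) (x : R) : R := ln x / ln 2.

(* For p n = c / n the value p n exceeds 1 when n < c; this affects only
   finitely many n and hence not the limit. *)
Definition aas_treedepth_Theta (R : realType) (p f : nat -> R) : Prop :=
  exists a b : R, [/\ 0 < a, a <= b &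
    ((fun n : nat => Gnp_prob (p n)
        [pred G : sgraph 'I_n |
           (a * f n <= (treedepth G)%:R) && ((treedepth G)%:R <= b * f n)])
      @ \oo --> (1 : R))%classic].

(* Main.v *)
Require Import Defs.
From mathcomp Require Import all_boot all_order all_algebra zify ring lra.

Set Implicit Arguments.
Unset Strict Implicit.
Unset Printing Implicit Defensive.

(** Upper bounds for c <= 1.  Explore the component of a vertex.  If the
    exploration stops within s steps and meets at most r edges that close a
    cycle, then deleting r vertices leaves a forest on at most s vertices, so the
    component has treedepth at most r + log s + 1.  Potentials exponential in the
    number of active vertices bound the exponential moments of the exploration:
    with probability 1 - o(1 / n) one has s = O(log n) and r = 1 if c < 1, and
    s = O((n ^ 2 log n) ^ (1 / 3)) and r = O(log n) if c = 1.

    Lower bounds for c <= 1.  A path on k vertices forces 2 ^ td > k, and the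
    second moment method yields a path with about log n vertices if c < 1, and
    with about n ^ (1 / 4) vertices if c = 1.

    Lower bound for c > 1.  If td were a small multiple of n, then deleting a small
    set S of vertices would leave only components with at most delta n vertices.
    An exploration of the rest would then discover at most s + delta n vertices in
    s steps, instead of the typical c s.  This has a probability exponentially
    small in n, which beats the number of choices of S. *)

(** * Treedepth of finite graphs *)

(** Upper bounds are proved for depth labellings of the vertices rather than for parent functions:
    labellings restrict, glue and extend easily, and only [treedepth_ranked] turns one into a
    forest. The union bound over the n starting vertices asks for error probabilities o(1 / n); this
    is why exponential moments are used. For c = 1 a comparison with a critical branching process
    has no drift. The drift comes from depletion: with j of s steps left, at most n - s + j vertices
    are unprocessed, so a step discovers at most about 1 - (s - j) / n vertices on average. Summed
    over the steps this gives a probability of order exp (- s ^ 3 / (16 n ^ 2)), whence s of order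
    (n ^ 2 log n) ^ (1 / 3). Closing edges are counted through the expectation of (1 + mu) ^ r along
    the same exploration, so the shape of the component never has to be analysed. All estimates hold
    for fixed n with explicit constants and an error of order 1 / log n. *)

Section Ranking.
Variables (T : finType) (e : rel T).
Hypothesis e_sym : symmetric e.
Implicit Types (W : {set T}) (k : nat).

Definition at_least W (d : T -> nat) j : rel T :=
  [rel u v | [&& e u v, u \in W, v \in W, j <= d u & j <= d v]].

(* d x plays the role of the depth of x in an elimination forest of W. *)
Definition ranked W k := exists d : T -> nat,
  (forall x, x \in W -> d x < k) /\
  (forall x y, x \in W -> y \in W -> d x = d y ->
     connect (at_least W d (d x)) x y -> x = y).

Lemma at_least_sym W d j : symmetric (at_least W d j).
Proof.
move=> x y; rewrite /at_least /= e_sym.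
by case: (e y x) (x \in W) (y \in W) (j <= d x) => [] [] [] [] //=; case: leqP.
Qed.

Lemma at_least_connect_sym W d j : connect_sym (at_least W d j).
Proof. exact: sym_connect_sym (@at_least_sym W d j). Qed.

Lemma ranked_mono W W' k k' :
  W' \subset W -> k <= k' -> ranked W k -> ranked W' k'.
Proof.
move=> /subsetP sWW lek [d [dk dinj]]; exists d; split=> [x /sWW/dk|x y Wx Wy dxy cxy].
  by move/leq_trans; apply.
apply: dinj; rewrite ?sWW //; apply: connect_sub cxy => u v /and5P[euv Wu Wv hu hv].
by apply: connect1; rewrite /at_least /= euv !sWW ?hu.
Qed.

(** [v] becomes the root: it gets depth 0, all other depths go up by one, and a connection through
    positive depths avoids [v]. *)
Lemma ranked_add W k v : ranked (W :\ v) k -> ranked W k.+1.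
Proof.
move=> [d [dk dinj]]; exists (fun x => if x == v then 0 else (d x).+1).
split=> [x Wx|x y Wx Wy].
  by case: eqP => // /eqP xv; rewrite ltnS dk // !inE xv.
have [->|xv] := eqVneq x v; have [->|yv] := eqVneq y v => // -[dxy] cxy.
apply: dinj; rewrite ?inE ?xv ?yv //; apply: connect_sub cxy => z w.
rewrite /at_least /=; case: (eqVneq z v) => [->|zv]; case: (eqVneq w v) => [->|wv];
  rewrite ?ltn0 ?andbF //= !ltnS => /and5P[ezw Wz Ww hz hw].
by apply: connect1; rewrite /= ezw !inE zv wv Wz Ww hz.
Qed.

Lemma ranked_remove (S W : {set T}) k :
  ranked (W :\: S) k -> ranked W (#|S| + k).
Proof.
have [m] := ubnP #|S|; elim: m S W => // m IHm S W.
have [->|[v Sv]] := set_0Vmem S; first by rewrite setD0 cards0.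
rewrite (cardsD1 v) Sv ltnS add1n addSn => ltm h.
apply: (@ranked_add _ _ v); apply: IHm => //.
by rewrite setDDl setD1K.
Qed.

(** A connection inside [W] never changes its label, so rankings chosen independently on the fibres
    of [l] glue without extra depth. *)
Lemma ranked_fibres (L : finType) (l : T -> L) W k :
    (forall x y, x \in W -> y \in W -> e x y -> l x = l y) ->
    (forall x, x \in W -> ranked [set y in W | l y == l x] k) -> ranked W k.
Proof.
move=> le hfib.
have /fin_all_exists[D hD] (i : L) : exists d : T -> nat,
  (forall x, x \in [set y in W | l y == i] -> d x < k) /\
  (forall x y, x \in [set y in W | l y == i] -> y \in [set y in W | l y == i] -> d x = d y ->
     connect (at_least [set y in W | l y == i] d (d x)) x y -> x = y).
  have [/existsP[x /andP[Wx /eqP<-]]|/existsPn no] := boolP [exists x, (x \in W) && (l x == i)].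
    exact: hfib Wx.
  have nW x : x \in [set y in W | l y == i] = false.
    by rewrite inE; apply/negbTE/no.
  by exists (fun=> 0); split=> x; rewrite ?nW // => y; rewrite nW.
exists (fun x => D (l x) x); split=> [x Wx|x y Wx Wy dxy cxy].
  by have [+ _] := hD (l x); apply; rewrite inE Wx /=.
have lcon z : connect (at_least W (fun x => D (l x) x) (D (l x) x)) x z -> l x = l z /\
   connect (at_least [set y in W | l y == l x] (D (l x)) (D (l x) x)) x z.
  move/connectP=> [s + ->] {z}; elim/last_ind: s => [|s z IHs] /=.
    by rewrite connect0.
  rewrite rcons_path last_rcons => /andP[/IHs[lx cx] /and5P[ez W1 W2 h1 h2]].
  have lz := le _ _ W1 W2 ez.
  split; first by rewrite lx.
  apply: connect_trans cx _; apply: connect1.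
  by move: h1 h2; rewrite /at_least /= ez !inE W1 W2 -lz -lx eqxx /= => -> ->.
have [lxy cxy'] := lcon _ cxy.
have [_ inj] := hD (l x); apply: inj cxy'; rewrite ?inE ?Wx ?Wy -?lxy ?eqxx //.
by move: dxy; rewrite -lxy.
Qed.

(** Label each vertex with its component. A closed set containing [x] contains the component of [x],
    so its ranking restricts to the fibre. *)
Lemma ranked_closed_cover k :
    (forall x, exists2 C : {set T}, x \in C &
       (forall y z, y \in C -> e y z -> z \in C) /\ ranked C k) ->
  ranked setT k.
Proof.
move=> hC; apply: (@ranked_fibres _ (fun x => [set y | connect e x y])) => [x y _ _ exy|x _].
  apply/setP=> z; rewrite !inE; apply/idP/idP; last exact/connect_trans/connect1.
  by apply/connect_trans/connect1; rewrite e_sym.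
have [C Cx [Ccl /(ranked_mono _ (leqnn k))]] := hC x; apply.
apply/subsetP=> y; rewrite !inE => /= /eqP/setP/(_ y); rewrite !inE connect0 => /esym.
move/connectP=> [s es ->] {y}.
elim: s x Cx es => //= z s IHs x Cx /andP[exz]; apply: IHs.
exact: Ccl exz.
Qed.

(* The hypothesis presents W as a forest: each vertex of W has at most one
   neighbour of smaller rho in W, its parent. *)
Lemma ranked_forest (rho : T -> nat) k W :
    #|W| < 2 ^ k ->
    (forall x y, x \in W -> y \in W -> e x y -> rho x != rho y) ->
    (forall x y z, x \in W -> y \in W -> z \in W -> e x y -> e x z ->
       rho y < rho x -> rho z < rho x -> y = z) ->
  ranked W k.
Proof.
elim: k W => [|k IHk] W cW rneq runiq.
  have W0 : W = set0 by apply/eqP; rewrite -cards_eq0; lia.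
  by exists (fun=> 0); rewrite W0; split=> x; rewrite ?inE.
(* [par] leads from a vertex to its parent, and [D v] is the subtree below [v]. *)
pose par : rel T := [rel x y | [&& e x y, x \in W, y \in W & rho y < rho x]].
pose D v := [set x in W | connect par x v].
have IH W' : W' \subset W -> #|W'| < 2 ^ k -> ranked W' k.
  move=> /subsetP sW c'; apply: IHk => // [x y /sW ? /sW ?|x y z /sW ? /sW ? /sW ?].
    exact: rneq.
  exact: runiq.
have DW v : D v \subset W by apply/subsetP=> x; rewrite inE => /andP[].
have conn_rho x y : connect par x y -> x = y \/ rho y < rho x.
  move/connectP=> [s + ->] {y}; elim: s x => [|y s IHs] x /=; first by left.
  by case/andP=> /and4P[_ _ _ r] /IHs[<-|]; right=> //; lia.
have first x y : connect par x y -> x <> y -> exists2 z, par x z & connect par z y.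
  move/connectP=> [[|z s] /= es ->] // nxy; case/andP: es => xz sz; exists z => //.
  by apply/connectP; exists s.
have last x y : connect par x y -> x <> y -> exists2 z, par z y & connect par x z.
  move/connectP=> [s + ->]; elim/last_ind: s => //= s z _; rewrite rcons_path last_rcons.
  by case/andP=> ps pz _; exists (last x s) => //; apply/connectP; exists s.
(* The vertices in [P] are roots of subtrees, and their parents lie outside [W']. Hence the set of
   such subtrees containing a vertex is constant along the edges of [W'] and can serve as its
   label. *)
have split_by (P : pred T) (W' : {set T}) : W' \subset W ->
    (forall c y, P c -> par c y -> y \notin W') ->
    (forall x, x \in W' -> ranked [set y in W' |
       [set c | P c & y \in D c] == [set c | P c & x \in D c]] k) -> ranked W' k.
  move=> sW' hP; apply: ranked_fibres.
  have step x y : x \in W' -> y \in W' -> e x y -> rho y < rho x ->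
      [set c | P c & x \in D c] = [set c | P c & y \in D c].
    move=> W'x W'y exy r; have [Wx Wy] := (subsetP sW' _ W'x, subsetP sW' _ W'y).
    have pxy : par x y by rewrite /par /= exy Wx Wy.
    apply/setP=> c; rewrite !inE; apply/andP/andP=> -[Pc /andP[_ cc]]; split=> //.
      have [xc|/eqP xc] := eqVneq x c; first by have := hP c y Pc; rewrite -xc pxy W'y => /(_ isT).
      rewrite Wy; have [z /and4P[exz _ Wz rz] zc] := first _ _ cc xc.
      by rewrite (runiq x y z).
    by rewrite Wx; apply: connect_trans cc; apply: connect1.
  move=> x y W'x W'y exy; have := rneq x y (subsetP sW' _ W'x) (subsetP sW' _ W'y) exy.
  rewrite neq_ltn => /orP[r|r]; last exact: step.
  by apply/esym/step; rewrite // e_sym.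
have small (P : pred T) W' x c : c \in [set c | P c & x \in D c] ->
    #|D c| < 2 ^ k -> ranked [set y in W' | [set c | P c & y \in D c] == [set c | P c & x \in D c]] k.
  move=> hc Dc; apply: ranked_mono (leqnn k) (IH (D c) (DW c) Dc).
  by apply/subsetP=> y; rewrite inE => /andP[_ /eqP/setP/(_ c)]; rewrite hc inE => /andP[].
(* Centroid argument: remove a vertex [v] of maximal [rho] among those with at least 2 ^ k
   descendants. The subtrees of its children are smaller by maximality, and [W :\: D v] is smaller
   than 2 ^ k by subtraction. *)
have [/existsP[v0 h0]|/existsPn no] := boolP [exists v, (v \in W) && (2 ^ k <= #|D v|)].
  case: (@arg_maxnP _ v0 (fun v => (v \in W) && (2 ^ k <= #|D v|)) rho h0) => v /andP[Wv Dv] vmax.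
  apply: (@ranked_add _ _ v); apply: (split_by (par^~ v)) => [|c y /= pcv pcy|x].
  - exact: subsetDl.
  - rewrite !inE; case/and4P: pcv => e1 Wc _ r1; case/and4P: pcy => e2 _ Wy r2.
    by rewrite (runiq c y v) ?eqxx.
  move=> W'x; have [E|[c hc]] := set_0Vmem [set c | par c v & x \in D c].
    rewrite E; apply: IH; first by apply/subsetP=> y; rewrite !inE -andbA => /and3P[].
    have : [set y in W :\ v | [set c | par c v & y \in D c] == set0] \subset W :\: D v.
      apply/subsetP=> y; rewrite !inE -andbA => /and3P[/eqP yv Wy /eqP/setP hy].
      rewrite Wy andbT; apply/negP=> yDv.
      have [z pz cz] := last _ _ yDv yv.
      by have := hy z; rewrite !inE pz Wy cz.
    move/subset_leq_card; have := cardsID (D v) W; rewrite (setIidPr (DW v)).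
    move: cW Dv; rewrite expnS; lia.
  apply: (small _ _ _ c) => //; move: hc; rewrite inE => /andP[/and4P[_ Wc _ r] _].
  rewrite ltnNge; apply/negP=> hc; have := vmax c; rewrite Wc hc /= => /(_ isT); lia.
(* No subtree is large, so the whole trees, labelled by their roots, already fit depth [k]. *)
apply: ranked_mono (subxx W) (leqnSn k) _.
apply: (split_by (fun c => [forall y, ~~ par c y])) => // [c y|x Wx].
  by move=> /forallP/(_ y)/negPf->.
have h0 : connect par x x by exact: connect0.
case: (@arg_minnP _ x (connect par x) rho h0) => c cxc cmin.
have Wc : c \in W.
  have [<-//|/eqP xc] := eqVneq x c; have [z /and4P[]//] := last _ _ cxc xc.
apply: (small _ _ _ c).
  have xDc : x \in D c by rewrite inE Wx.
  rewrite inE xDc andbT; apply/forallP=> y; apply/negP=> pcy.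
  have := cmin y (connect_trans cxc (connect1 pcy)); case/and4P: pcy; lia.
by have := no c; rewrite Wc /= -ltnNge.
Qed.
End Ranking.

Definition adj (T : finType) (E : {set {set T}}) : rel T :=
  [rel x y | (x != y) && ([set x; y] \in E)].

Lemma adj_sym (T : finType) (E : {set {set T}}) : symmetric (adj E).
Proof. by move=> x y; rewrite /adj /= eq_sym setUC. Qed.

Lemma forest_closureP (T : finType) (F : {ffun T -> option T}) (x y : T) :
  x != y -> ([set x; y] \in forest_closure F) = ancestor F x y || ancestor F y x.
Proof.
move=> nxy; apply/imset2P/idP=> [[u v _]|/orP[] a].
- rewrite !inE /= => /andP[nuv a] /setP eq2; move: (eq2 u) (eq2 v); rewrite !inE !eqxx orbT /=.
  by case/orP=> /eqP eu; case/orP=> /eqP ev; move: nuv a; rewrite eu ev ?eqxx // => _ ->; rewrite ?orbT.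
- by exists x y; rewrite ?inE ?nxy.
- by rewrite setUC; exists y x; rewrite ?inE // eq_sym nxy.
Qed.

Section TreedepthUpper.
Variables (T : finType) (G : sgraph T) (k : nat).

(** The ancestors of [x] are taken to be the [y] of no larger depth that are joined to [x] through
    depths at least [d y]. They form a chain on which [d] is injective, so the deepest proper one
    can be the parent and there are at most [k] of them. *)
Lemma treedepth_ranked : ranked (adj G) setT k -> treedepth G <= k.
Proof.
move=> [d [dk dinj]]; have e_sym := @adj_sym T G.
pose al := at_least (adj G) setT d.
pose up y x := (d y <= d x) && connect (al (d y)) y x.
have al_sub i j : i <= j -> subrel (connect (al j)) (connect (al i)).
  move=> ij; apply: connect_sub => u v /and5P[e1 _ _ h1 h2]; apply: connect1.
  by rewrite /al /at_least /= e1 !inE !(leq_trans ij).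
have al_sym i := at_least_connect_sym e_sym setT d i.
have up_eq y x : up y x -> d y = d x -> y = x.
  by case/andP=> _ c dyx; apply: dinj; rewrite ?inE.
have up_trans y z x : up y z -> up z x -> up y x.
  move=> /andP[yz cyz] /andP[zx czx]; rewrite /up (leq_trans yz zx) /=.
  exact: connect_trans cyz (al_sub _ _ yz _ _ czx).
have up_refl x : up x x by rewrite /up leqnn connect0.
have up_chain x y z : up y x -> up z x -> d y <= d z -> up y z.
  move=> /andP[yx cyx] /andP[zx czx] yz; rewrite /up yz /=.
  by apply: connect_trans cyx _; rewrite al_sym; apply: al_sub yz _ _ czx.
pose F : {ffun T -> option T} := [ffun x =>
  if [pick y | up y x && (y != x)] is Some y0 then
    Some [arg max_(y > y0 | up y x && (y != x)) d y] else None].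
have FS x z : F x = Some z -> [/\ up z x, z != x & forall y, up y x -> y != x -> up y z].
  rewrite ffunE; case: pickP => // y0 h0 [<-].
  case: arg_maxnP => // w /andP[upw wx] wmax; split=> // y uy yx.
  by apply: (up_chain x) => //; apply: wmax; rewrite uy.
have FN x : F x = None -> forall y, up y x -> y = x.
  rewrite ffunE; case: pickP => // no _ y uy; apply/eqP.
  by have := no y; rewrite uy /=; case: eqP.
have Fd x z : F x = Some z -> d z < d x.
  case/FS=> uz zx _; have /andP[le _] := uz; rewrite ltn_neqAle le andbT.
  by apply: contra zx => /eqP h; apply/eqP/up_eq.
have ancP y x : ancestor F y x = up y x.
  apply/idP/idP.
    move/connectP=> [s + ->] {y}; elim: s x => [|z s IHs] x //=.
    by case/andP=> /eqP/FS[uz _ _] /IHs/up_trans; apply.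
  have [n] := ubnP (d x); elim: n x => // n IHn x lt uy.
  have [->|yx] := eqVneq y x; first exact: connect0.
  case Fx: (F x) => [z|]; last by move: yx; rewrite (FN _ Fx _ uy) eqxx.
  apply: (@connect_trans _ _ z); first by apply: connect1; rewrite /parent_rel /= Fx.
  apply: IHn; first by have := Fd _ _ Fx; lia.
  by have [_ _] := FS _ _ Fx; apply.
have Fr : rooted_forest F.
  apply/forallP=> x; have [n] := ubnP (d x); elim: n x => // n IHn x lt.
  case Fx: (F x) => [z|]; last by apply/existsP; exists x; rewrite Fx ancP up_refl.
  have /existsP[r /andP[Fr ar]] : [exists r, (F r == None) && ancestor F r z].
    by apply: IHn; have := Fd _ _ Fx; lia.
  apply/existsP; exists r; rewrite Fr /=; apply: connect_trans ar.
  by apply: connect1; rewrite /parent_rel /= Fx.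
have FE : edges G \subset forest_closure F.
  apply/subsetP=> e Ee; have := subsetP (edgesP G) _ Ee.
  rewrite inE => /cards2P[x [y [nxy exy]]]; rewrite exy forest_closureP // !ancP.
  have axy : adj G x y by rewrite /adj /= nxy -exy.
  apply/orP; case: (leqP (d x) (d y)) => [le|/ltnW le]; [left|right].
    by rewrite /up le /=; apply: connect1; rewrite /al /at_least /= axy !inE leqnn le.
  by rewrite /up le /=; apply: connect1; rewrite /al /at_least /= e_sym axy !inE leqnn le.
have Fh : forest_height F <= k.
  apply/bigmax_leqP=> x _; rewrite -[k in _ <= k]card_ord.
  have k0 : 0 < k by apply: leq_ltn_trans (dk x (in_setT x)).
  case: k k0 dk => // k' _ dk'.
  rewrite -(@card_in_imset _ _ (fun y => inord (d y) : 'I_k'.+1)) ?max_card // => y z.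
  rewrite !inE !ancP => uy uz /(congr1 val); rewrite /= !inordK ?dk' ?inE // => eqd.
  by apply: up_eq (eqd); apply: (up_chain x) => //; rewrite eqd.
rewrite /treedepth; case: ex_minnP => m _ /(_ (forest_height F)) mmin.
apply: leq_trans (mmin _) Fh; apply/existsP; exists F; rewrite Fr FE /=.
exact: eqxx.
Qed.
End TreedepthUpper.

(** * Paths and separators in elimination forests *)

Section TreedepthLower.
Variables (T : finType) (F : {ffun T -> option T}).
Hypothesis Froot : rooted_forest F.
Implicit Types (S : {set T}) (e : rel T).

Let anc := ancestor F.

Lemma ancestor_refl x : anc x x. Proof. exact: connect0. Qed.

Lemma ancestor_trans : transitive anc.
Proof. by move=> y x z xy yz; apply: connect_trans yz xy. Qed.

Lemma ancestor_chain x y z : anc y x -> anc z x -> anc y z || anc z y.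
Proof.
move/connectP=> [s + ->] {y}; elim: s x => [|w s IHs] x /=; first by move=> _ ->; rewrite orbT.
case/andP=> /eqP Fx ps /connectP[[|w' s'] /=].
  move=> _ ->; apply/orP; left; apply/connectP; exists (w :: s) => //.
  by apply/andP; split=> //; apply/eqP.
case/andP=> /eqP; rewrite Fx => -[<-] ps' ez; apply: (IHs w) => //; apply/connectP; exists s' => //.
Qed.

(** Induction on the path from [x] to a root: a cycle through [x] would also pass through its
    parent, which is closer to the root. *)
Lemma ancestor_anti x y : anc y x -> anc x y -> x = y.
Proof.
have /existsP[r /andP[/eqP Fr /connectP[s]]] := forallP Froot x.
elim: s x y => [|x' s IHs] x y /=.
  by move=> _ rx /connectP[[|w s] //= /andP[/eqP]]; rewrite -rx Fr.
case/andP=> /eqP Fx ps er ayx axy.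
have step z : anc z x -> z != x -> anc z x'.
  move/connectP=> [[|w s'] /=]; first by move=> _ ->; rewrite eqxx.
  by case/andP=> /eqP; rewrite Fx => -[<-] ps' -> _; apply/connectP; exists s' => //.
apply/eqP; rewrite eq_sym; apply/negPn/negP=> nyx; have ayx' := step _ ayx nyx.
have ax'x : anc x' x by apply: connect1; rewrite /parent_rel /= Fx.
have axx' : anc x x' by apply: ancestor_trans axy _.
have eqx : x' = x by apply: IHs.
by move: nyx; rewrite -(IHs x' y) // eqx ?eqxx.
Qed.

Definition up_closed S := forall x y, x \in S -> anc y x -> y \in S.

(* Off the up-closed set S the forest splits into subtrees; this is the
   singleton of the root of the subtree of x. *)
Definition top_off S x := [set z | [&& z \notin S, anc z x &
  [forall w, anc w z ==> ((w == z) || (w \in S))]]].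

Lemma top_off_anc S x y : x \notin S -> y \notin S -> anc y x -> top_off S x = top_off S y.
Proof.
move=> xS yS yx; apply/setP=> z; rewrite !inE; apply/and3P/and3P=> -[zS az /forallP h].
  split=> //; last exact/forallP.
  have /orP[//|yz] := ancestor_chain az yx.
  by have := h y; rewrite yz (negPf yS) orbF => /eqP->; apply: ancestor_refl.
by split=> //; [apply: ancestor_trans yx | apply/forallP].
Qed.

Lemma top_off_neq0 S x : x \notin S -> exists z, z \in top_off S x.
Proof.
move=> xS; have h0 : (x \notin S) && anc x x by rewrite xS ancestor_refl.
case: (@arg_minnP _ x (fun z => (z \notin S) && anc z x) (fun z => #|[set y | anc y z]|) h0).
move=> z /andP[zS zx] zmin; exists z; rewrite !inE zS zx; apply/forallP=> w.
apply/implyP=> wz; case: (boolP (w \in S)) => wS; rewrite ?orbT // orbF.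
have {zmin} := zmin w; rewrite wS (ancestor_trans wz zx) => /(_ isT).
apply: contraTT => nwz; rewrite -ltnNge; apply: proper_card; apply/properP; split.
  by apply/subsetP=> y; rewrite !inE => /ancestor_trans; apply.
exists z; rewrite !inE ?ancestor_refl //; apply: contra nwz => zw.
by rewrite (ancestor_anti zw wz).
Qed.

Definition subtree z := [set x | anc z x].

Lemma top_off_subtree S x z :
  z \in top_off S x -> [set y in ~: S | top_off S y == top_off S x] \subset subtree z.
Proof.
move=> hz; apply/subsetP=> y; rewrite inE => /andP[_ /eqP hy].
by move: hz; rewrite -hy !inE => /and3P[].
Qed.

Lemma sum_subtree : \sum_z #|subtree z| = \sum_x #|[set z | anc z x]|.
Proof.
under eq_bigr do rewrite -sum1_card big_mkcond.
rewrite exchange_big; apply: eq_bigr => x _; rewrite -sum1_card [RHS]big_mkcond /=.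
by apply: eq_bigr => z _; rewrite !inE.
Qed.

(** Consecutive vertices of the path are comparable, so the path stays in one subtree off [S]. The
    root of that subtree occurs at most once and cuts the path into two pieces; adding the roots of
    all subtrees to [S] lowers [K] by one. *)
Lemma path_size_off e K S (s : seq T) :
    (forall x y, e x y -> anc x y || anc y x) ->
    up_closed S -> (forall x, x \notin S -> #|[set z | anc z x] :\: S| <= K) ->
  uniq s -> sorted e s -> all [predC S] s -> size s < 2 ^ K.
Proof.
move=> eanc; elim: K S s => [|K IHK] S s Sup hK us ps /allP sS.
  case: s us ps sS => // x s _ _ /(_ x (mem_head _ _)) /= xS.
  have := hK x xS; rewrite leqn0 cards_eq0 => /eqP/setP/(_ x).
  by rewrite !inE (negPf xS : x \in S = false) ancestor_refl.
have lab x : x \in s -> x \notin S by move/sS.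
have const x y : x \in s -> y \in s -> top_off S x = top_off S y.
  have {}ps : forall x0, {in s, forall x, top_off S x = top_off S (head x0 s)}.
    move=> x0; elim: s {us sS} ps lab => // w s IHs /= pw lab x'.
    rewrite inE => /predU1P[->//|xs'].
    have sn : s = head x0 s :: behead s by case: (s) xs'.
    have hs : head x0 s \in s by rewrite sn mem_head.
    rewrite IHs ?(path_sorted pw) // => [|z zs]; last by rewrite lab // inE zs orbT.
    have ew : e w (head x0 s) by move: pw; rewrite sn /= => /andP[].
    case/orP: (eanc _ _ ew) => a; first by apply: top_off_anc; rewrite ?lab ?inE ?eqxx ?hs ?orbT.
    by apply/esym/top_off_anc; rewrite ?lab ?inE ?eqxx ?hs ?orbT.
  by move=> xs ys; rewrite (ps x) // (ps x y).
pose M := [set z | z \in top_off S z].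
have Mx x z : z \in top_off S x -> z \in M.
  by rewrite !inE => /and3P[-> _ ->]; rewrite ancestor_refl.
have S'up : up_closed (S :|: M).
  move=> x y; rewrite in_setU => /orP[xS a|]; first by rewrite in_setU (Sup x).
  rewrite !inE => /and3P[xS ax /forallP h] a; have := h y; rewrite a /=.
  by case/orP=> [/eqP->|->]; rewrite ?(xS, ax) //=; apply/orP; right; apply/forallP.
have hK' x : x \notin S :|: M -> #|[set z | anc z x] :\: (S :|: M)| <= K.
  rewrite in_setU negb_or => /andP[xS xM]; rewrite -ltnS; apply: leq_trans (hK x xS).
  apply: proper_card; apply/properP; split; first by apply: setDS; apply: subsetUl.
  have [z hz] := top_off_neq0 xS; have zM := Mx _ _ hz.
  exists z; last by rewrite in_setD in_setU zM orbT.
  by move: hz; rewrite !inE => /and3P[-> -> _].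
have Muniq x y : x \in s -> y \in s -> x \in M -> y \in M -> x = y.
  move=> xs ys; rewrite inE (const x y) // inE => /and3P[xS a _].
  rewrite !inE => /and3P[_ _ /forallP/(_ x)]; rewrite a (negPf xS) orbF /=.
  by move/eqP.
have sub s' : subseq s' s -> sorted e s' -> {in s', forall x, x \notin M} -> size s' < 2 ^ K.
  move=> ss ps' nM; apply: (IHK (S :|: M)) => //; first exact: subseq_uniq ss us.
  by apply/allP=> x xs /=; rewrite inE negb_or lab ?nM //; apply: (mem_subseq ss).
have [/hasP[z zs zM]|/hasPn no] := boolP (has (mem M) s); last first.
  by apply: leq_trans (sub s (subseq_refl s) ps no) _; rewrite expnS leq_pmull.
have nM x : x \in s -> x != z -> x \notin M.
  by move=> xs; apply: contra => xM; apply/eqP/Muniq.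
case/splitPr: zs us ps sub nM => s1 s2 us ps sub nM.
have /cat_sorted2[ps1 /path_sorted ps2] := ps.
have h1 : size s1 < 2 ^ K.
  apply: sub => // [|x xs1]; first exact: prefix_subseq.
  apply: nM; rewrite ?mem_cat ?xs1 //; apply: contraTneq us => xz.
  by rewrite cat_uniq /= -xz xs1 /= !andbF.
have h2 : size s2 < 2 ^ K.
  apply: sub => // [|x xs2].
    by apply: subseq_trans (subseq_cons s2 z) (suffix_subseq _ _).
  apply: nM; rewrite ?mem_cat ?inE ?xs2 ?orbT //; apply: contraTneq us => xz.
  by rewrite cat_uniq /= -xz xs2 /= !andbF.
by rewrite size_cat /= expnS; move: h1 h2; move: (2 ^ K) (size s1) (size s2) => t a b; lia.
Qed.
End TreedepthLower.

Section TreedepthLowerGraph.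
Variables (T : finType) (G : sgraph T).

Lemma treedepth_forest : exists F : {ffun T -> option T},
  [/\ rooted_forest F, forall x y, adj G x y -> ancestor F x y || ancestor F y x &
   forall x, #|[set z | ancestor F z x]| <= treedepth G].
Proof.
rewrite /treedepth; case: ex_minnP => h /existsP[F /and3P[Fr /subsetP FE /eqP <-]] _.
exists F; split=> // [x y /andP[nxy /FE]|x]; first by rewrite forest_closureP.
by apply: (leq_bigmax_cond (F := fun x => #|[set y | ancestor F y x]|)).
Qed.

Lemma path_size_treedepth (s : seq T) :
  uniq s -> sorted (adj G) s -> size s < 2 ^ treedepth G.
Proof.
have [F [Fr FE Fh]] := treedepth_forest => us ps.
apply: (@path_size_off _ F Fr (adj G) _ set0) => //.
- by move=> x y; rewrite inE.
- by move=> x _; rewrite setD0.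
- by apply/allP=> x; rewrite /= inE.
Qed.

(* S consists of the vertices with more than L descendants; counting pairs of a
   vertex and an ancestor bounds its cardinality. *)
Lemma treedepth_separator L : exists (S : {set T}) (l : T -> {set T}),
  [/\ #|S| * L <= #|T| * treedepth G,
      forall x y, x \notin S -> y \notin S -> adj G x y -> l x = l y &
      forall x, x \notin S -> #|[set y in ~: S | l y == l x]| <= L].
Proof.
have [F [Fr FE Fh]] := treedepth_forest.
pose S := [set z | L < #|subtree F z|]; exists S, (top_off F S); split.
- have h : \sum_(z : T) #|subtree F z| <= #|T| * treedepth G.
    rewrite sum_subtree -sum_nat_const; apply: leq_sum => x _; exact: Fh.
  apply: leq_trans h; rewrite -sum_nat_const [leqRHS](bigID (mem S)) /=.
  apply: leq_trans (leq_addr _ _); apply: leq_sum => z; rewrite inE => /ltnW //.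
- move=> x y xS yS /FE/orP[] a; last exact: top_off_anc.
  exact/esym/top_off_anc.
- move=> x xS; have [z hz] := top_off_neq0 Fr xS.
  apply: leq_trans (subset_leq_card (top_off_subtree hz)) _.
  by move: hz; rewrite !inE -leqNgt => /and3P[].
Qed.
End TreedepthLowerGraph.

Import Order.TTheory GRing.Theory Num.Theory.

(** * Random subsets *)

Section RandomSubset.
Local Open Scope ring_scope.
Variables (R : realFieldType) (p : R).

Definition weight (I : finType) (D H : {set I}) : R :=
  \prod_(e in D) (if e \in H then p else 1 - p).

Definition expect (I : finType) (D : {set I}) (f : {set I} -> R) : R :=
  \sum_(H : {set I} | H \subset D) weight D H * f H.

Variable I : finType.
Implicit Types (D H : {set I}) (f g : {set I} -> R).

Lemma eq_expect D f g :
  (forall H, H \subset D -> f H = g H) -> expect D f = expect D g.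
Proof. by move=> efg; apply: eq_bigr => H sH; rewrite efg. Qed.

(** Independence of the choices on disjoint sets, as an iterated expectation; conditioning on
    exposed edges takes this form. *)
Lemma expectU D1 D2 f : [disjoint D1 & D2] ->
  expect (D1 :|: D2) f =
  expect D1 (fun H1 => expect D2 (fun H2 => f (H1 :|: H2))).
Proof.
move=> dis; rewrite /expect.
under [RHS]eq_bigr do rewrite big_distrr.
rewrite pair_big_dep /= (reindex_onto (fun h => h.1 :|: h.2) (fun H => (H :&: D1, H :&: D2))) /=; last first.
  by move=> H sH; rewrite -setIUr; apply/setIidPl.
have dI H1 H2 : H1 \subset D1 -> H2 \subset D2 ->
    ((H1 :|: H2) :&: D1 = H1) * ((H1 :|: H2) :&: D2 = H2).
  move=> s1 s2; rewrite !setIUl (setIidPl s1) (setIidPl s2).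
  have /disjoint_setI0 -> : [disjoint H2 & D1].
    by rewrite disjoint_sym; apply: disjointWr s2 dis.
  by have /disjoint_setI0 -> := disjointWl s1 dis; rewrite setU0 set0U.
apply: eq_big => [[H1 H2] /=|[H1 H2] /= /andP[sH eH]].
  apply/andP/andP=> [[sH /eqP[e1 e2]]|[s1 s2]].
    by rewrite -e1 -e2 !subsetIr.
  by rewrite !dI // setUSS.
have [s1 s2] : H1 \subset D1 /\ H2 \subset D2.
  by move/eqP: eH => [<- <-]; rewrite !subsetIr.
rewrite mulrA; congr (_ * _); rewrite /weight (eq_bigl [in [predU D1 & D2]]) => [|e]; last by rewrite !inE.
rewrite bigU //=; congr (_ * _).
  apply: eq_bigr => e De; rewrite inE orbC.
  by case: (boolP (e \in H2)) => // /(subsetP s2) De'; have := disjointFr dis De; rewrite De'.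
apply: eq_bigr => e De; rewrite inE.
by case: (boolP (e \in H1)) => // /(subsetP s1) De'; have := disjointFl dis De; rewrite De'.
Qed.

Lemma expect_prod D (a b : I -> R) :
  expect D (fun H => \prod_(e in D) (if e \in H then a e else b e)) =
  \prod_(e in D) (p * a e + (1 - p) * b e).
Proof.
pose F e := if e \in D then p * a e else 0.
pose G e := if e \in D then (1 - p) * b e else 1.
have -> : \prod_(e in D) (p * a e + (1 - p) * b e) = \prod_e (F e + G e).
  by rewrite big_mkcond; apply: eq_bigr => e _; rewrite /F /G; case: ifP => // _; rewrite add0r.
rewrite bigA_distr (bigID (fun H : {set I} => H \subset D)) /= [X in _ + X]big1 ?addr0.
  apply: eq_bigr => H sH; rewrite -big_split big_mkcond /=; apply: eq_bigr => e _.
  rewrite /F /G; case: (boolP (e \in H)) => [/(subsetP sH)->//|_].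
  by case: ifP.
move=> H /subsetPn[e He nDe]; rewrite (bigD1 e) //= He /F (negPf nDe) mul0r //.
Qed.

Lemma expect1 D : expect D (fun=> 1) = 1.
Proof.
transitivity (\prod_(e in D) (p * 1 + (1 - p) * 1)).
  by rewrite -expect_prod; apply: eq_expect => H _; rewrite big1 // => e _; rewrite if_same.
by rewrite big1 // => e _; rewrite !mulr1 addrC subrK.
Qed.

Lemma expect_sub D (E : {set I}) : E \subset D ->
  expect D (fun H => (E \subset H)%:R) = p ^+ #|E|.
Proof.
move=> sED.
have := expect_prod D (fun=> 1) (fun e => (e \notin E)%:R).
rewrite (big_setID E) /= (setIidPr sED) [X in _ * X]big1 ?mulr1; last first.
  by move=> e; rewrite inE => /andP[nE _]; rewrite nE !mulr1 addrC subrK.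
rewrite (eq_bigr (fun=> p)) => [|e eE]; last by rewrite eE mulr0 addr0.
rewrite prodr_const => <-; apply: eq_expect => H sH.
have [/subsetP sEH|/subsetPn[e Ee nHe]] := boolP (E \subset H).
  rewrite big1 // => e _; case: ifP => // /negbT nHe.
  by rewrite (contra (sEH e) nHe).
by rewrite (bigD1 e) ?(subsetP sED) //= (negPf nHe) Ee mul0r.
Qed.

Lemma expectD D f g : expect D (fun H => f H + g H) = expect D f + expect D g.
Proof. by rewrite /expect -big_split; apply: eq_bigr => H _; rewrite mulrDr. Qed.

Lemma expectZ D a f : expect D (fun H => a * f H) = a * expect D f.
Proof. by rewrite /expect big_distrr; apply: eq_bigr => H _; rewrite mulrCA. Qed.

Lemma expect_sum D (J : Type) (r : seq J) (P : pred J) (F : J -> {set I} -> R) :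
  expect D (fun H => \sum_(j <- r | P j) F j H) = \sum_(j <- r | P j) expect D (F j).
Proof.
rewrite /expect exchange_big; apply: eq_bigr => H _; exact: big_distrr.
Qed.

Hypothesis p01 : 0 <= p <= 1.

Lemma weight_ge0 D H : 0 <= weight D H.
Proof.
by case/andP: p01 => p0 p1; apply: prodr_ge0 => e _; case: ifP => // _; rewrite subr_ge0.
Qed.

Lemma le_expect D f g :
  (forall H, H \subset D -> f H <= g H) -> expect D f <= expect D g.
Proof.
by move=> lefg; apply: ler_sum => H sH; rewrite ler_wpM2l ?weight_ge0 ?lefg.
Qed.

End RandomSubset.

(** Serves to identify the random set of edges at a vertex with the random set of its neighbours. *)
Lemma expect_imset (R : realFieldType) (p : R) (I J : finType) (h : I -> J)
    (W : {set I}) (f : {set J} -> R) : {in W &, injective h} ->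
  expect p (h @: W) f = expect p W (fun N => f (h @: N)).
Proof.
move=> injh; rewrite /expect.
rewrite (reindex_onto (fun N : {set I} => h @: N) (fun H => W :&: h @^-1: H)) /=; last first.
  move=> H /subsetP sH; apply/setP=> y; apply/imsetP/idP=> [[x]|Hy].
    by rewrite !inE => /andP[_ ?] ->.
  by have /imsetP[x Wx eyx] := sH y Hy; exists x => //; rewrite !inE Wx -eyx.
apply: eq_big => [N|N /andP[_ /eqP eN]].
  apply/andP/idP=> [[_ /eqP<-]|sN]; first exact: subsetIl.
  split; first exact: imsetS.
  apply/eqP/setP=> x; rewrite !inE; apply/andP/idP=> [[Wx /imsetP[x' Nx' /injh->]]|Nx] //.
    exact: (subsetP sN).
  by rewrite (subsetP sN) // imset_f.
have sN : N \subset W by rewrite -eN subsetIl.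
congr (_ * _)%R; rewrite /weight big_imset //=; apply: eq_bigr => x Wx.
congr (if _ then _ else _); apply/imsetP/idP=> [[y Ny /injh->]|Nx] //; last by exists x.
exact: (subsetP sN).
Qed.

(** * Exposing the edges at one vertex *)

Section Exposure.
Local Open Scope ring_scope.
Variables (R : realFieldType) (p : R) (T : finType).
Implicit Types (v : T) (W N : {set T}) (H : {set {set T}}).

Definition vpairs_in W := [set e in vpairs T | e \subset W].
Definition star v W := (fun w => [set v; w]) @: W.

Lemma set2_inj v W : v \notin W -> {in W &, injective (fun w => [set v; w])}.
Proof.
move=> nvW x y Wx Wy /setP/(_ x); rewrite !inE eqxx orbT => /esym/orP[]/eqP // xv.
by rewrite -xv Wx in nvW.
Qed.

Lemma vpairs_inU1 v W : v \notin W ->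
  vpairs_in (v |: W) = star v W :|: vpairs_in W /\ [disjoint star v W & vpairs_in W].
Proof.
move=> nvW; split.
  apply/setP=> e; rewrite !inE; apply/andP/orP.
    move=> [/cards2P[x [y [nxy ->]]] /subsetP sW].
    have := sW x; have := sW y; rewrite !inE !eqxx orbT => /(_ isT) hy /(_ isT) hx.
    case/predU1P: hx hy => [xv|Wx] /predU1P[yv|Wy].
    - by rewrite xv yv eqxx in nxy.
    - by left; apply/imsetP; exists y; rewrite ?xv.
    - by left; apply/imsetP; exists x; rewrite // yv setUC.
    by right; rewrite cards2 nxy; apply/subsetP=> z; rewrite !inE => /orP[]/eqP->.
  move=> [/imsetP[w Ww ->]|/andP[-> sW]]; last by split=> //; apply: subset_trans sW (subsetUr _ _).
  rewrite cards2; split; first by have -> : v != w by apply: contraNneq nvW => ->.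
  by apply/subsetP=> z; rewrite !inE => /orP[]/eqP->; rewrite ?eqxx // Ww orbT.
rewrite disjoint_subset; apply/subsetP=> e /imsetP[w Ww ->]; rewrite !inE negb_and.
by apply/orP; right; apply: contra nvW => /subsetP; apply; rewrite !inE eqxx.
Qed.

(** Deferred decisions: once the neighbours [N] of [v] are drawn, the graph on [W] is still a fresh
    random graph. *)
Lemma expect_expose v W (f : {set {set T}} -> R) : v \notin W ->
  expect p (vpairs_in (v |: W)) f =
  expect p W (fun N => expect p (vpairs_in W) (fun H => f (star v N :|: H))).
Proof.
move=> nvW; have [-> dis] := vpairs_inU1 nvW.
by rewrite expectU // expect_imset //; apply: set2_inj.
Qed.

Lemma adj_star v W N H : v \notin W -> N \subset W -> H \subset vpairs_in W ->
  (forall w, w \in W -> adj (star v N :|: H) v w = (w \in N)) /\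
  (forall x y, x \in W -> y \in W -> adj (star v N :|: H) x y = adj H x y).
Proof.
move=> nvW /subsetP sN /subsetP sH; split=> [w Ww|x y Wx Wy]; rewrite /adj /= inE.
  have -> : v != w by apply: contraNneq nvW => ->.
  apply/orP/idP=> [[/imsetP[w' Nw' /(set2_inj nvW)->]|/sH]|Nw] //; rewrite ?sN //.
    by rewrite inE => /andP[_ /subsetP/(_ v)]; rewrite !inE eqxx (negPf nvW) => /(_ isT).
  by left; apply: imset_f.
congr (_ && _); case: imsetP => // -[w Nw /setP/(_ v)].
rewrite !inE eqxx /= => /orP[]/eqP vx; move: nvW; rewrite vx ?Wx ?Wy //.
Qed.

End Exposure.

(** * Explorations *)

Section Exploration.
Variable T : finType.
Implicit Types (e : rel T) (A U : {set T}).

Definition discovered e (v : T) U := [set u in U | e v u].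

(* Explores a component with s steps left: A is the set of discovered vertices
   still to be processed, U the set of undiscovered ones.  The result counts the
   edges found inside A, which close cycles; None means that s was too small. *)
Fixpoint explore e s A U : option nat :=
  if [pick v in A] is Some v then
    if s is s'.+1 then
      omap (addn #|discovered e v (A :\ v)|)
        (explore e s' (A :\ v :|: discovered e v U) (U :\: discovered e v U))
    else None
  else Some 0.

Lemma discovered_sub e v U : discovered e v U \subset U.
Proof. by apply/subsetP=> x; rewrite inE => /andP[]. Qed.

Lemma explore_unionE e v A U : v \in A -> [disjoint A & U] ->
  (A :\ v :|: discovered e v U) :|: (U :\: discovered e v U) = (A :|: U) :\ v.
Proof.
move=> Av dis; rewrite -setUA -[discovered e v U in X in _ :|: (X :|: _)](setIidPr (discovered_sub e v U)).
rewrite setID setDUl; congr (_ :|: _); apply/esym/setDidPl.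
by rewrite disjoint_sym disjoints1 (disjointFr dis Av).
Qed.

Lemma explore_disjoint e v A U : [disjoint A & U] ->
  [disjoint A :\ v :|: discovered e v U & U :\: discovered e v U].
Proof.
move=> dis; rewrite -setI_eq0 setIUl; apply/eqP/setP=> x; rewrite !inE.
case: (boolP (x \in A)) => [Ax|]; first by rewrite (disjointFr dis Ax) ?andbF.
by rewrite andbF /=; case: (x \in U); rewrite ?andbF //= andbT andbN.
Qed.

(** The edges of a processed vertex are never consulted again, so the rest of the exploration
    depends on unexposed edges alone. *)
Lemma eq_explore e e' s A U : [disjoint A & U] ->
    (forall x y, x \in A :|: U -> y \in A :|: U -> e x y = e' x y) ->
  explore e s A U = explore e' s A U.
Proof.
elim: s A U => [|s IHs] A U dis ee' //=; case: pickP => // v Av.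
have ed (B : {set T}) : B \subset A :|: U -> discovered e v B = discovered e' v B.
  move=> /subsetP sB; apply/setP=> x; rewrite !inE; case: (boolP (x \in B)) => //= Bx.
  by apply: ee'; [rewrite inE Av | apply: sB].
rewrite !ed ?subsetUr //; last by apply: subset_trans (subD1set A v) (subsetUl _ _).
congr omap; apply: IHs => [|x y]; first exact: explore_disjoint.
rewrite explore_unionE // => /setD1P[_ hx] /setD1P[_ hy]; exact: ee'.
Qed.

(* S collects the vertices that close a cycle when they are processed; without
   them the discovery order rho presents the component C as a forest. *)
Lemma explore_forest e s A U r : symmetric e -> irreflexive e ->
    [disjoint A & U] -> explore e s A U = Some r ->
  exists (C S : {set T}) (rho : T -> nat),
  [/\ A \subset C, C \subset A :|: U,
      forall y z, y \in C -> z \in A :|: U -> e y z -> z \in C,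
      #|C| <= s /\ #|S| <= r &
      [/\ forall x, x \in A -> rho x = 0,
          forall x y, x \in C :\: S -> y \in C :\: S -> e x y -> rho x != rho y &
          forall x y z, x \in C :\: S -> y \in C :\: S -> z \in C :\: S ->
            e x y -> e x z -> rho y < rho x -> rho z < rho x -> y = z]].
Proof.
move=> e_sym e_irr.
have stop A' U' (s' r' : nat) : A' =i pred0 -> exists (C S : {set T}) (rho : T -> nat),
  [/\ A' \subset C, C \subset A' :|: U',
      forall y z, y \in C -> z \in A' :|: U' -> e y z -> z \in C,
      #|C| <= s' /\ #|S| <= r' &
      [/\ forall x, x \in A' -> rho x = 0,
          forall x y, x \in C :\: S -> y \in C :\: S -> e x y -> rho x != rho y &
          forall x y z, x \in C :\: S -> y \in C :\: S -> z \in C :\: S ->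
            e x y -> e x z -> rho y < rho x -> rho z < rho x -> y = z]].
  move=> nA; have -> : A' = set0 by apply/setP=> x; rewrite nA !inE.
  exists set0, set0, (fun=> 0); split; rewrite ?sub0set ?cards0 ?setD0 //.
    by move=> y z; rewrite inE.
  by split=> // x y; rewrite inE.
elim: s A U r => [|s IHs] A U r dis /=.
  by case: pickP => // nA _; apply: stop.
case: pickP => [v Av|nA _]; last exact: stop.
set X := discovered e v U; case ex: explore => [r'|] //= [<-].
have [C [S [rho [AC CAU Ccl [cC cS] [rA rneq runiq]]]]] := IHs _ _ _ (explore_disjoint e v dis) ex.
rewrite explore_unionE // -/X in CAU Ccl AC rA *.
have nvC : v \notin C by apply/negP => /(subsetP CAU); rewrite !inE eqxx.
(* [v] is deleted when one of its edges closes a cycle. All of [A] can share rank 0, because among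
   two adjacent waiting vertices the one processed earlier gets deleted. *)
pose S' := if discovered e v (A :\ v) == set0 then S else v |: S.
pose rho' x := if x \in A then 0 else (rho x).+1.
exists (v |: C), S', rho'.
have AvC : A :\ v \subset C by apply: subset_trans AC; apply: subsetUl.
have XC : X \subset C by apply: subset_trans AC; apply: subsetUr.
have vX z : z \in U -> e v z -> z \in X by rewrite !inE => -> ->.
have memC x : x \in (v |: C) :\: S' -> x = v \/ x \in C :\: S.
  rewrite /S'; case: ifP => _; rewrite !inE.
    by case/andP=> -> /predU1P[->|->]; [left|right].
  by case: eqP => [->|_] /=; [left|right].
have nbv x : v \in (v |: C) :\: S' -> x \in C -> e v x -> x \in X /\ x \notin A.
  rewrite /S'; case: ifP => [/eqP/setP d0 _ xC evx|_]; last by rewrite !inE eqxx.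
  have xAU := subsetP CAU _ xC; have := d0 x; move: xAU; rewrite !inE evx andbT.
  case: (x == v) => //=; case: (x \in A) => //= -> //.
have r0 x : x \in C -> x \in A -> rho x = 0.
  move=> xC xA; apply: rA; rewrite inE in_setD1 xA andbT.
  by rewrite (_ : x != v) //; apply: contraNneq nvC => <-.
have CS x : x \in C :\: S -> x \in C by rewrite inE => /andP[].
have rv : rho' v = 0 by rewrite /rho' Av.
have rX x : x \in X -> x \notin A -> rho' x = 1.
  by move=> xX /negPf xA; rewrite /rho' xA rA // inE xX orbT.
have rlt x y : x \in C :\: S -> y \in C :\: S -> e x y -> rho' y < rho' x -> rho y < rho x.
  move=> hx hy exy; rewrite /rho'; case: ifP => [yA|_]; case: ifP => // _; rewrite ?ltnS // => _.
  rewrite (r0 y) ?CS // lt0n; apply: contraNneq (rneq x y hx hy exy) => ->; rewrite (r0 y) ?CS //.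
split.
- by apply/subsetP=> x Ax; rewrite !inE; case: eqP => //= /eqP xv; apply: (subsetP AvC); rewrite !inE xv.
- rewrite subUset sub1set inE Av /=; apply: subset_trans CAU _; apply: subD1set.
- move=> y z; rewrite !inE; case: (eqVneq z v) => // zv /= hy zAU eyz.
  case/predU1P: hy => [yv|hy]; last by apply: (Ccl y) => //; rewrite !inE zv.
  case/orP: zAU => [zA|zU]; first by apply: (subsetP AvC); rewrite !inE zv.
  by apply: (subsetP XC); apply: vX; rewrite -?yv.
- split; first by rewrite cardsU1 nvC.
  rewrite /S'; case: eqP => [->|/eqP]; first by rewrite cards0.
  rewrite -card_gt0 => h; rewrite cardsU1; by apply: leq_add cS; apply: leq_trans h; case: (v \notin S).
split.
- by move=> x Ax; rewrite /rho' Ax.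
- move=> x y hx hy exy; case: (memC x hx) (memC y hy) => [xv|Cx] [yv|Cy].
  + by rewrite xv yv e_irr in exy.
  + rewrite xv in hx exy *; have [yX yA] := nbv y hx (CS _ Cy) exy.
    by rewrite rv rX.
  + rewrite yv e_sym in hy exy *; have [xX xA] := nbv x hy (CS _ Cx) exy.
    by rewrite rv rX.
  rewrite /rho'; case: ifP => xA; case: ifP => yA //.
    have := rneq x y Cx Cy exy; rewrite !r0 ?CS //.
  by rewrite eqSS; apply: rneq.
move=> x y z hx hy hz exy exz ryx rzx.
case: (memC x hx) => [xv|Cx]; first by move: ryx; rewrite xv rv.
(* A neighbour [x] of an undeleted [v] was discovered by [v]. It has rank 0 in the recursive order,
   which leaves no room for a second neighbour of smaller rank. *)
have vcase w t : x \in C :\: S -> w = v -> w \in (v |: C) :\: S' -> e x w -> t \in C :\: S -> e x t -> rho' t < rho' x -> False.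
  move=> _ wv hw exw Ct ext rtx; rewrite wv e_sym in hw exw.
  have [xX xA] := nbv x hw (CS _ Cx) exw.
  by have := rlt _ _ Cx Ct ext rtx; rewrite (rA x) ?ltn0 // inE xX orbT.
case: (memC y hy) (memC z hz) => [yv|Cy] [zv|Cz].
- by move: yv zv => -> ->.
- by case: (vcase y z).
- by case: (vcase z y).
by apply: (runiq x) => //; apply: rlt.
Qed.

Lemma ranked_explore e s k r v : symmetric e -> irreflexive e -> s < 2 ^ k ->
    explore e s [set v] (~: [set v]) = Some r ->
  exists2 C : {set T}, v \in C &
    (forall y z, y \in C -> e y z -> z \in C) /\ ranked e C (r + k).
Proof.
move=> e_sym e_irr ltk ex; have dis : [disjoint [set v] & ~: [set v]].
  by rewrite disjoints_subset setCK.
have [C [S [rho [AC _ Ccl [cC cS] [_ rneq runiq]]]]] := explore_forest e_sym e_irr dis ex.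
exists C; first by rewrite -sub1set.
split=> [y z yC|]; first by apply: Ccl yC _; rewrite setUCr inE.
apply: (ranked_mono (subxx C) (_ : #|S| + k <= _)); first by rewrite leq_add2r.
apply: ranked_remove; apply: (ranked_forest e_sym _ rneq runiq).
by apply: leq_ltn_trans ltk; apply: leq_trans cC; apply: subset_leq_card; apply: subsetDl.
Qed.

End Exploration.

(** * Exponential moments of the exploration of a component *)

Section ExplorationWeight.
Local Open Scope ring_scope.
Variables (R : realFieldType) (p : R) (T : finType).
Hypothesis p01 : 0 <= p <= 1.

(** Joint generating function of two independent binomial counts: the edges from the processed
    vertex to active and to undiscovered vertices. *)
Lemma expect_colors (A U : {set T}) (a u : R) : [disjoint A & U] ->
  expect p (A :|: U) (fun N => a ^+ #|N :&: A| * u ^+ #|N :&: U|) =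
  (1 + p * (a - 1)) ^+ #|A| * (1 + p * (u - 1)) ^+ #|U|.
Proof.
move=> dis; have cexp (N B : {set T}) (x : R) : x ^+ #|N :&: B| = \prod_(e in B) (if e \in N then x else 1).
  by rewrite -prodr_const [LHS]big_mkcond [RHS]big_mkcond; apply: eq_bigr => e _; rewrite inE; do 2!case: (_ \in _).
rewrite expectU // -!prodr_const.
rewrite (eq_bigr (fun=> p * a + (1 - p) * 1)) => [|e _]; last by ring.
rewrite [X in _ = _ * X](eq_bigr (fun=> p * u + (1 - p) * 1)) => [|e _]; last by ring.
rewrite -!expect_prod mulrC -expectZ; apply: eq_expect => N1 s1.
rewrite mulrC -expectZ; apply: eq_expect => N2 s2; rewrite -!cexp !setIUl.
have /disjoint_setI0 -> : [disjoint N2 & A].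
  by rewrite disjoint_sym; apply: disjointWr s2 dis.
by have /disjoint_setI0 -> := disjointWl s1 dis; rewrite setU0 set0U.
Qed.

Variables (mu al om : R) (N S : nat) (F G : nat -> R).

(** One weight for two uses: [al = 0], [om = 1] gives the indicator of an unfinished exploration,
    [al = 1], [om = 0] the exponential moment of the number of closing edges. *)
Definition explore_weight (o : option nat) : R :=
  if o is Some r then al * (1 + mu) ^+ r else om.

Hypotheses (mu0 : 0 <= mu) (al0 : 0 <= al) (om0 : 0 <= om) (G1 : forall s, 1 <= G s).
Hypotheses (alF : forall s, al <= F s) (omF : om <= F 0%N).
(* With s steps left and A discovered, F s * G s ^+ #|A| is a supermartingale
   along the exploration: G decreases in time to pay for the closing edges. *)
Hypothesis stepG : forall s, (s < S)%N -> (1 + p * mu) * G s <= G s.+1.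
Hypothesis stepF : forall s, (s < S)%N -> F s * (1 + p * (G s - 1)) ^+ (N + s) <= F s.+1 * G s.

(** Averaging over the edges at the processed vertex, each of the [a] other active vertices costs 1
    + p mu, absorbed by the growth of [G]. Each of the [u] undiscovered ones costs 1 + p (G s - 1),
    paid by the factor [G s] of the processed vertex and the change of [F]. *)
Lemma explore_step_le s a u : (s < S)%N -> (u <= N + s)%N ->
  F s * G s ^+ a * ((1 + p * mu) ^+ a * (1 + p * (G s - 1)) ^+ u) <=
  F s.+1 * G s.+1 ^+ a.+1.
Proof.
move=> sS leu; have /andP[p0 p1] := p01.
have F0 n : 0 <= F n by apply: le_trans (alF n).
have G0 n : 0 <= G n by apply: le_trans ler01 (G1 n).
have h1 : 1 <= 1 + p * (G s - 1) by rewrite lerDl mulr_ge0 // subr_ge0.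
have h2 : 0 <= 1 + p * mu by rewrite addr_ge0 // mulr_ge0.
have h3 : G s <= G s.+1.
  by apply: le_trans (stepG sS); rewrite ler_peMl // lerDl mulr_ge0.
have hG := stepG sS.
have h4 : ((1 + p * mu) * G s) ^+ a <= G s.+1 ^+ a.
  by rewrite lerXn2r // ?nnegrE // mulr_ge0.
have h5 := ler_weXn2l h1 leu.
have -> : F s * G s ^+ a * ((1 + p * mu) ^+ a * (1 + p * (G s - 1)) ^+ u) =
    ((1 + p * mu) * G s) ^+ a * (F s * (1 + p * (G s - 1)) ^+ u).
  rewrite exprMn; move: (G s ^+ a) ((1 + p * mu) ^+ a) ((1 + p * (G s - 1)) ^+ u) => x y z.
  by rewrite [F s * x]mulrC !mulrA; congr (_ * _); rewrite mulrAC [x * y]mulrC.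
have -> : F s.+1 * G s.+1 ^+ a.+1 = G s.+1 ^+ a * (F s.+1 * G s.+1).
  by rewrite exprSr mulrCA.
have hp : 0 <= (1 + p * (G s - 1)) ^+ u by rewrite exprn_ge0 // (le_trans ler01).
apply: ler_pM => //; rewrite ?exprn_ge0 ?mulr_ge0 //.
apply: le_trans (ler_wpM2l (F0 s) h5) _; apply: le_trans (stepF sS) _.
exact: ler_wpM2l.
Qed.

(** Induction on the steps left, exposing the edges at the picked vertex. The number of unprocessed
    vertices and its bound [N + s] both drop by one per step; this is how depletion enters. *)
Lemma expect_explore s (A U : {set T}) : (s <= S)%N -> [disjoint A & U] -> (#|A| + #|U| <= N + s)%N ->
  expect p (vpairs_in (A :|: U)) (fun H => explore_weight (explore (adj H) s A U)) <=
  F s * G s ^+ #|A|.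
Proof.
have F0 n : 0 <= F n by apply: le_trans (alF n).
have G0 n : 0 <= G n by apply: le_trans ler01 (G1 n).
have /andP[p0 p1] := p01.
elim: s A U => [|s IHs] A U sS dis cAU.
  rewrite (eq_expect p (g := fun=> explore_weight (explore (fun _ _ => false) 0 A U) * 1)) => [|H _].
    rewrite expectZ expect1 mulr1 /=; case: pickP => [v Av|nA] /=.
      by apply: le_trans omF _; rewrite ler_peMr // exprn_ege1.
    rewrite expr0 mulr1; have -> : A = set0 by apply/setP=> x; rewrite inE nA.
    by rewrite cards0 expr0 mulr1.
  by rewrite mulr1 /=.
case epick: [pick v in A] => [v|]; last first.
  rewrite (eq_expect p (g := fun=> al * 1)) => [|H _]; last by rewrite /= epick /= expr0.
  rewrite expectZ expect1 mulr1; have -> : A = set0.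
    by move: epick; case: pickP => // nA _; apply/setP=> x; rewrite inE nA.
  by rewrite cards0 expr0 mulr1.
have Av : v \in A by move: epick; case: pickP => // w Aw [<-].
pose W := (A :\ v) :|: U.
have nvU : v \notin U by rewrite (disjointFr dis Av).
have nvW : v \notin W by rewrite !inE eqxx.
have disA : [disjoint A :\ v & U] by apply: disjointWl (subD1set _ _) dis.
have -> : A :|: U = v |: W by rewrite /W setUA setD1K.
rewrite expect_expose //.
have cA := cardsD1 v A; rewrite Av add1n in cA.
rewrite cA addSn addnS ltnS in cAU.
apply: le_trans (_ : expect p W (fun N1 => F s * G s ^+ #|A :\ v| *
   ((1 + mu) ^+ #|N1 :&: (A :\ v)| * G s ^+ #|N1 :&: U|)) <= _).
  apply: le_expect => // N1 sN1.
  pose A' := (A :\ v) :|: (N1 :&: U); pose U' := U :\: (N1 :&: U).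
  have dis' : [disjoint A' & U'].
    rewrite -setI_eq0; apply/eqP/setP=> x; rewrite !inE.
    case: (boolP (x \in A)) => [Ax|]; first by rewrite (disjointFr dis Ax) ?andbF.
    by rewrite andbF /=; case: (x \in U); rewrite ?andbF //= !andbT andbN.
  have eW : A' :|: U' = W.
    rewrite /A' /U' /W -setUA; congr (_ :|: _).
    by apply/setP=> x; rewrite !inE; case: (x \in U); case: (x \in N1).
  have cA' : #|A'| = (#|A :\ v| + #|N1 :&: U|)%N.
    have dI := disjointWr (subsetIr N1 U) disA.
    by rewrite cardsU (disjoint_setI0 dI) cards0 subn0.
  have cU' : (#|A'| + #|U'| = #|W|)%N by rewrite -eW cardsU disjoint_setI0 // cards0 subn0.
  have cW : #|W| = (#|A :\ v| + #|U|)%N by rewrite cardsU disjoint_setI0 // cards0 subn0.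
  apply: le_trans (_ : (1 + mu) ^+ #|N1 :&: (A :\ v)| * (F s * G s ^+ #|A'|) <= _); last first.
    by rewrite cA' exprD [leRHS]mulrCA -!mulrA.
  have mu1 : 0 <= (1 + mu) ^+ #|N1 :&: (A :\ v)| by rewrite exprn_ge0 // addr_ge0.
  have cAU' : (#|A'| + #|U'| <= N + s)%N by rewrite cU' cW.
  apply: le_trans (ler_wpM2l mu1 (IHs A' U' (ltnW sS) dis' cAU')).
  rewrite -expectZ eW; apply: le_expect => // H sH.
  have [advW adW] := adj_star nvW sN1 sH.
  rewrite /= epick.
  have dE (B : {set T}) : B \subset W -> discovered (adj (star v N1 :|: H)) v B = N1 :&: B.
    move=> /subsetP sB; apply/setP=> x; rewrite !inE andbC; case: (boolP (x \in B)) => [Bx|]; rewrite ?andbF //.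
    by rewrite !andbT advW ?sB.
  rewrite !dE ?subsetUl ?subsetUr // -/A' -/U'.
  rewrite (@eq_explore _ _ (adj H)) // => [|x y]; last by rewrite eW; apply: adW.
  case: explore => [r|] /=; first by rewrite exprD mulrCA.
  (* An unfinished exploration forgets its closing edges; the extra factor on the right is at least
     1. *)
  by rewrite ler_peMl // exprn_ege1 // lerDl.
rewrite expectZ expect_colors //.
rewrite [X in 1 + p * X]addrAC subrr add0r cA.
by apply: explore_step_le => //; apply: leq_trans cAU; apply: leq_addl.
Qed.
End ExplorationWeight.

(** * Exploration of the whole graph *)

Section GlobalExploration.
Variable T : finType.
Implicit Types (e : rel T) (A U : {set T}).

(* Number of undiscovered vertices after s steps of an exploration of the whole
   graph, which starts a new component whenever no discovered vertex is left. *)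
Fixpoint unseen e s A U : nat :=
  if s is s'.+1 then
    if [pick v in A] is Some v then
      unseen e s' (A :\ v :|: discovered e v U) (U :\: discovered e v U)
    else if [pick v in U] is Some v then
      unseen e s' ([set v] :\ v :|: discovered e v (U :\ v))
        (U :\ v :\: discovered e v (U :\ v))
    else 0
  else #|U|.

Lemma disjoint_pick v U : [disjoint [set v] & U :\ v].
Proof. by rewrite disjoints1 !inE eqxx. Qed.

Lemma eq_unseen e e' s A U : [disjoint A & U] ->
    (forall x y, x \in A :|: U -> y \in A :|: U -> e x y = e' x y) ->
  unseen e s A U = unseen e' s A U.
Proof.
elim: s A U => [|s IHs] A U dis ee' //=.
have ed v (B : {set T}) : v \in A :|: U -> B \subset A :|: U -> discovered e v B = discovered e' v B.
  move=> Av /subsetP sB; apply/setP=> x; rewrite !inE; case: (boolP (x \in B)) => //= Bx.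
  by apply: ee'; [|apply: sB].
case: pickP => [v Av|_].
  have vAU : v \in A :|: U by rewrite inE Av.
  rewrite !ed ?subsetUr //; apply: IHs => [|x y]; first exact: explore_disjoint.
  by rewrite explore_unionE // => /setD1P[_ hx] /setD1P[_ hy]; apply: ee'.
case: pickP => // v Uv; have vAU : v \in A :|: U by rewrite inE Uv orbT.
have sU : U :\ v \subset A :|: U by apply: subset_trans (subsetUr _ _); apply: subD1set.
rewrite !ed //; apply: IHs => [|x y]; first exact/explore_disjoint/disjoint_pick.
rewrite explore_unionE ?set11 ?disjoint_pick // setD1K //.
by move=> /(subsetP sU) hx /(subsetP sU) hy; apply: ee'.
Qed.

Lemma unseen_le e s A U : unseen e s A U <= #|U|.
Proof.
elim: s A U => [|s IHs] A U //=; case: pickP => [v Av|_].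
  by apply: leq_trans (IHs _ _) _; apply: subset_leq_card; apply: subsetDl.
case: pickP => // v Uv; apply: leq_trans (IHs _ _) _; apply: subset_leq_card.
by apply: subset_trans (subsetDl _ _) (subD1set _ _).
Qed.

Lemma explore_card e v A U : v \in A -> [disjoint A & U] ->
  #|A :\ v :|: discovered e v U| + #|U :\: discovered e v U| = (#|A| + #|U|).-1.
Proof.
move=> Av dis; have cU (B C : {set T}) : [disjoint B & C] -> #|B :|: C| = #|B| + #|C|.
  by move=> dBC; rewrite cardsU (disjoint_setI0 dBC) cards0 subn0.
rewrite -!cU ?explore_disjoint // (cardsD1 v (A :|: U)) inE Av /=.
by rewrite (explore_unionE e Av dis).
Qed.

(** The active vertices always lie in a single class of [l], so at most [m] vertices are discovered
    but unprocessed, and at most [s] are processed. *)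
Lemma unseen_ge (L : eqType) (l : T -> L) (i : L) (m : nat) e s A U :
    [disjoint A & U] ->
    (forall x y, x \in A :|: U -> y \in A :|: U -> e x y -> l x = l y) ->
    (forall j, #|[set x in A :|: U | l x == j]| <= m) ->
    (forall x, x \in A -> l x = i) ->
  #|A| + #|U| <= unseen e s A U + s + m.
Proof.
have step A' U' v : v \in A' -> [disjoint A' & U'] ->
    (forall x y, x \in A' :|: U' -> y \in A' :|: U' -> e x y -> l x = l y) ->
    (forall x, x \in A' -> l x = l v) ->
    forall x, x \in A' :\ v :|: discovered e v U' -> l x = l v.
  move=> Av dis le lA x; rewrite !inE => /orP[/andP[_]|/andP[xU exv]]; first exact: lA.
  by apply/esym/le; rewrite // inE ?Av ?xU ?orbT.
elim: s A U i => [|s IHs] A U i dis le lm lA /=.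
  rewrite addn0 addnC leq_add2l; apply: leq_trans (lm i); apply: subset_leq_card.
  by apply/subsetP=> x Ax; rewrite !inE Ax lA /=.
case: pickP => [v Av|nA].
  have lv : forall x, x \in A -> l x = l v by move=> x Ax; rewrite !lA.
  have h := IHs (A :\ v :|: discovered e v U) (U :\: discovered e v U) (l v)
    (explore_disjoint e v dis) _ _ (step A U v Av dis le lv).
  rewrite explore_unionE // in h.
  have A0 : 0 < #|A| by apply/card_gt0P; exists v.
  have := h _ _; rewrite explore_card // => {}h.
  rewrite -(@prednK (#|A| + #|U|)) ?addn_gt0 ?A0 // addnS addSn ltnS; apply: h.
    by move=> x y /setD1P[_ hx] /setD1P[_ hy]; apply: le.
  by move=> j; apply: leq_trans (lm j); apply/subset_leq_card/subsetP=> x; rewrite !inE -andbA => /and3P[_ -> ->].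
have A0 : A = set0 by apply/setP=> x; rewrite inE nA.
rewrite A0 cards0 add0n set0U in le lm *.
case: pickP => [v Uv|nU]; last first.
  by have -> : U = set0 by [apply/setP=> x; rewrite inE nU]; rewrite cards0.
have UE : [set v] :|: (U :\ v) = U by rewrite setD1K.
have h := IHs _ _ (l v) (explore_disjoint e v (disjoint_pick v U)) _ _
   (step [set v] (U :\ v) v (set11 v) (disjoint_pick v U) _ _).
rewrite explore_unionE ?set11 ?disjoint_pick // UE explore_card ?set11 ?disjoint_pick // in h.
rewrite cards1 /= in h; rewrite (cardsD1 v) Uv add1n addnS addSn ltnS; apply: h => //.
- by move=> x y /setD1P[_ hx] /setD1P[_ hy]; apply: le.
- by move=> j; apply: leq_trans (lm j); apply/subset_leq_card/subsetP=> x; rewrite !inE -andbA => /and3P[_ -> ->].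
by move=> x /set1P->.
Qed.

End GlobalExploration.

Section GlobalExplorationWeight.
Local Open Scope ring_scope.
Variables (R : realFieldType) (p : R) (T : finType).
Hypothesis p01 : 0 <= p <= 1.
Variables (a : R) (m : nat).
Hypothesis a1 : 1 <= a.

(* Each vertex processed while at least m vertices are undiscovered multiplies
   the expectation of a ^+ (number of undiscovered vertices) by at most r ^+ m. *)
Let r := 1 + p * (a^-1 - 1).
Let phi (k : nat) : R := a ^+ k * (m <= k)%:R.

Let a0 : 0 < a. Proof. exact: lt_le_trans ltr01 a1. Qed.

Let r_itv : a^-1 <= r <= 1.
Proof.
have /andP[p0 p1] := p01; have ai1 : a^-1 <= 1 by rewrite invf_le1.
rewrite /r; nra.
Qed.

(** An undiscovered vertex keeps its factor a with probability 1 - p and loses it otherwise, so its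
    mean factor is a (1 - p) + p = a r. *)
Lemma expect_unseen_step s (A U : {set T}) v : v \in A -> [disjoint A & U] ->
    (forall A' U' : {set T}, [disjoint A' & U'] ->
      expect p (vpairs_in (A' :|: U')) (fun H => phi (unseen (adj H) s A' U')) <=
      a ^+ #|U'| * (r ^+ m) ^+ s) ->
  expect p (vpairs_in (A :|: U)) (fun H =>
    phi (unseen (adj H) s (A :\ v :|: discovered (adj H) v U) (U :\: discovered (adj H) v U))) <=
  (a * r) ^+ #|U| * (r ^+ m) ^+ s.
Proof.
move=> Av dis IH; pose W := (A :\ v) :|: U.
have nvU : v \notin U by rewrite (disjointFr dis Av).
have nvW : v \notin W by rewrite !inE eqxx.
have disA : [disjoint A :\ v & U] by apply: disjointWl (subD1set _ _) dis.
have -> : A :|: U = v |: W by rewrite /W setUA setD1K.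
rewrite expect_expose //.
apply: le_trans (_ : expect p W (fun N1 => (a ^+ #|U| * (r ^+ m) ^+ s) *
   (1 ^+ #|N1 :&: (A :\ v)| * a^-1 ^+ #|N1 :&: U|)) <= _); last first.
  by rewrite expectZ expect_colors // -/r subrr mulr0 addr0 expr1n mul1r mulrAC exprMn.
apply: le_expect => // N1 sN1.
pose A' := (A :\ v) :|: (N1 :&: U); pose U' := U :\: (N1 :&: U).
have dis' : [disjoint A' & U'].
  rewrite -setI_eq0; apply/eqP/setP=> x; rewrite !inE.
  case: (boolP (x \in A)) => [Ax|]; first by rewrite (disjointFr dis Ax) ?andbF.
  by rewrite andbF /=; case: (x \in U); rewrite ?andbF //= !andbT andbN.
have eW : A' :|: U' = W.
  rewrite /A' /U' /W -setUA; congr (_ :|: _).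
  by apply/setP=> x; rewrite !inE; case: (x \in U); case: (x \in N1).
have cU' : #|U| = (#|N1 :&: U| + #|U'|)%N.
  by rewrite -(cardsID (N1 :&: U) U) (setIidPr (subsetIr _ _)).
have -> : (a ^+ #|U| * (r ^+ m) ^+ s) * (1 ^+ #|N1 :&: (A :\ v)| * a^-1 ^+ #|N1 :&: U|) =
    a ^+ #|U'| * (r ^+ m) ^+ s.
  rewrite expr1n mul1r cU' exprD mulrAC; congr (_ * _).
  by rewrite mulrAC exprVn mulfV ?mul1r // expf_neq0 // gt_eqF.
apply: le_trans (IH A' U' dis'); rewrite eW; apply: le_expect => // H sH.
have [advW adW] := adj_star nvW sN1 sH.
have -> : discovered (adj (star v N1 :|: H)) v U = N1 :&: U.
  apply/setP=> x; rewrite !inE andbC; case: (boolP (x \in U)) => [Ux|]; rewrite ?andbF //.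
  by rewrite !andbT advW // inE Ux orbT.
rewrite -/A' -/U' (@eq_unseen _ _ (adj H)) // => x y.
by rewrite eW; apply: adW.
Qed.

(** If fewer than [m] vertices are undiscovered now, this remains so and [phi] vanishes at the end.
    Otherwise r ^ #|U| <= r ^ m, which gives one factor r ^ m per step. *)
Lemma expect_unseen s (A U : {set T}) : [disjoint A & U] ->
  expect p (vpairs_in (A :|: U)) (fun H => phi (unseen (adj H) s A U)) <=
  a ^+ #|U| * (r ^+ m) ^+ s.
Proof.
have /andP[ar r1] := r_itv; have r0 : 0 <= r by apply: le_trans ar; rewrite invr_ge0 ltW.
have q0 n : 0 <= (r ^+ m) ^+ n by rewrite exprn_ge0 ?exprn_ge0.
elim: s A U => [|s IHs] A U dis.
  rewrite (eq_expect p (g := fun=> phi #|U| * 1)) => [|H _]; last by rewrite mulr1.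
  rewrite expectZ expect1 mulr1 expr0.
  by rewrite /phi ler_wpM2l ?exprn_ge0 ?(ltW a0) //; case: (m <= _)%N; rewrite /= ?ler01 ?lexx.
have [ltU|leU] := ltnP #|U| m.
  rewrite (eq_expect p (g := fun=> 0 * 1)) => [|H _]; last first.
    by rewrite /phi mul0r leqNgt (leq_ltn_trans (unseen_le _ _ _ _) ltU) mulr0.
  by rewrite expectZ mul0r mulr_ge0 ?exprn_ge0 ?(ltW a0).
have rU : r ^+ #|U| <= r ^+ m by apply: ler_wiXn2l.
have fin : (a * r) ^+ #|U| * (r ^+ m) ^+ s <= a ^+ #|U| * (r ^+ m) ^+ s.+1.
  by rewrite exprMn exprS mulrA ler_wpM2r // ler_wpM2l ?exprn_ge0 ?(ltW a0).
case epick: [pick v in A] => [v|].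
  have Av : v \in A by move: epick; case: pickP => // w Aw [<-].
  apply: le_trans fin; apply: le_trans (expect_unseen_step Av dis IHs).
  by apply: le_expect => // H _ /=; rewrite epick.
have A0 : A = set0 by move: epick; case: pickP => // nA _; apply/setP=> x; rewrite inE nA.
case epickU: [pick v in U] => [v|]; last first.
  have U0 : U = set0 by move: epickU; case: pickP => // nU _; apply/setP=> x; rewrite inE nU.
  move: leU; rewrite U0 cards0 leqn0 => /eqP m0.
  rewrite (eq_expect p (g := fun=> 1 * 1)) => [|H _]; last first.
    by rewrite /= epick -U0 epickU /phi m0 expr0.
  by rewrite expectZ expect1 m0 !expr0 expr1n.
have Uv : v \in U by move: epickU; case: pickP => // w Aw [<-].
have UE : [set v] :|: (U :\ v) = U by rewrite setD1K.
apply: le_trans fin; rewrite A0 set0U -{1}UE.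
have cU := cardsD1 v U; rewrite Uv add1n in cU.
(* The start vertex of a new component leaves [U] unpaid; the bound survives because [a * r] is at
   least 1. *)
apply: le_trans (_ : (a * r) ^+ #|U :\ v| * (r ^+ m) ^+ s <= _); last first.
  have ar1 : 1 <= a * r by rewrite -(@mulfV _ a) ?ler_pM2l // gt_eqF.
  by rewrite cU ler_wpM2r // ler_weXn2l.
apply: le_trans (expect_unseen_step (set11 v) (disjoint_pick v U) IHs).
by apply: le_expect => // H _ /=; rewrite -A0 epick epickU.
Qed.

End GlobalExplorationWeight.

From mathcomp Require Import reals.

(** * Treedepth of the random graph: bounds for fixed n *)

Section GnpExpectation.
Local Open Scope ring_scope.
Variables (R : realType) (p : R).

Lemma expect_sgraph (T : finType) (f : {set {set T}} -> R) :
  expect p (vpairs T) f = \sum_(G : sgraph T) weight p (vpairs T) (edges G) * f (edges G).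
Proof.
rewrite /expect (reindex_omap (@edges T) insub) => [|H sH].
  by apply: eq_bigl => G; rewrite edgesP /= (_ : insub _ = Some G) ?eqxx // valK.
by rewrite insubT.
Qed.

(** Pairs not inside [W] average out; this passes to the part of the graph off a fixed separator. *)
Lemma expect_restrict (T : finType) (W : {set T}) (f : {set {set T}} -> R) :
  expect p (vpairs T) (fun H => f (H :&: vpairs_in W)) = expect p (vpairs_in W) f.
Proof.
have sW : vpairs_in W \subset vpairs T by apply/subsetP=> e; rewrite inE => /andP[].
have <- : vpairs_in W :|: (vpairs T :\: vpairs_in W) = vpairs T.
  by apply/setP=> e; rewrite in_setU in_setD; case: (boolP (e \in vpairs_in W)) => // /(subsetP sW)->.
have dis : [disjoint vpairs_in W & vpairs T :\: vpairs_in W].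
  by rewrite disjoints_subset; apply/subsetP=> e He; rewrite in_setC in_setD He.
rewrite expectU //; apply: eq_expect => H1 s1.
rewrite (eq_expect p (g := fun=> f H1 * 1)) => [|H2 s2]; first by rewrite expectZ expect1 mulr1.
rewrite mulr1 setIUl (setIidPl s1) disjoint_setI0 ?setU0 //.
by rewrite disjoint_sym; apply: disjointWr s2 dis.
Qed.

Lemma adj_restrict (T : finType) (W : {set T}) (H : {set {set T}}) x y :
  H \subset vpairs T -> x \in W -> y \in W -> adj (H :&: vpairs_in W) x y = adj H x y.
Proof.
move=> /subsetP sH Wx Wy; rewrite /adj /= inE; congr (_ && _).
case: (boolP (_ \in H)) => //= He; rewrite inE (sH _ He) /=.
by apply/subsetP=> z; rewrite !inE => /orP[]/eqP->.
Qed.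

Variable n : nat.
Implicit Types A B : pred (sgraph 'I_n).
Hypothesis p01 : 0 <= p <= 1.

(** Markov's inequality, with [f] dominating the indicator of [A]. *)
Lemma Gnp_prob_le A (f : {set {set 'I_n}} -> R) :
    (forall G, A G -> 1 <= f (edges G)) -> (forall H, 0 <= f H) ->
  Gnp_prob p A <= expect p (vpairs 'I_n) f.
Proof.
move=> f1 f0; rewrite expect_sgraph /Gnp_prob [leRHS](bigID A) /=.
rewrite -[leLHS]addr0 lerD ?sumr_ge0 // => [|G _]; last first.
  by rewrite mulr_ge0 ?weight_ge0.
by apply: ler_sum => G AG; rewrite ler_peMr ?f1 // weight_ge0.
Qed.

Lemma Gnp_prob_mono A B : (forall G, A G -> B G) -> Gnp_prob p A <= Gnp_prob p B.
Proof.
move=> AB; rewrite /Gnp_prob [leLHS]big_mkcond [leRHS]big_mkcond; apply: ler_sum => G _.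
have w0 := weight_ge0 p01 (vpairs 'I_n) (edges G).
by case: ifP => [/AB->|_] //; case: ifP => // _; apply: w0.
Qed.

Lemma Gnp_prob_compl A : Gnp_prob p A = 1 - Gnp_prob p (predC A).
Proof.
apply/eqP; rewrite eq_sym subr_eq -(expect1 p (vpairs 'I_n)) expect_sgraph.
rewrite (bigID A) /=; under eq_bigr do rewrite mulr1.
by under [X in _ + X == _]eq_bigr do rewrite mulr1.
Qed.

Lemma Gnp_prob_ge0 A : 0 <= Gnp_prob p A.
Proof. by apply: sumr_ge0 => G _; apply: (weight_ge0 p01 (vpairs 'I_n)). Qed.

Lemma Gnp_prob_le1 A : Gnp_prob p A <= 1.
Proof. by rewrite Gnp_prob_compl lerBlDr lerDl Gnp_prob_ge0. Qed.

Lemma Gnp_prob_union A B1 B2 : (forall G, ~~ A G -> B1 G || B2 G) ->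
  1 - (Gnp_prob p B1 + Gnp_prob p B2) <= Gnp_prob p A.
Proof.
move=> AB; rewrite (Gnp_prob_compl A) lerD2l lerN2 /Gnp_prob.
rewrite [X in _ <= X + _]big_mkcond [X in _ <= _ + X]big_mkcond -big_split big_mkcond /=.
have w0 (G : sgraph 'I_n) := weight_ge0 p01 (vpairs 'I_n) (edges G).
apply: ler_sum => G _; case: ifP => [/AB/orP[]->|_].
- by rewrite lerDl; case: ifP => // _; apply: w0.
- by rewrite lerDr; case: ifP => // _; apply: w0.
by rewrite addr_ge0 //; case: ifP => // _; apply: w0.
Qed.

Section TreedepthUpperProb.
(** The potentials [al_F], [al_G] control unfinished explorations, and [ex_F], [ex_G] the number of
    closing edges. *)
Variables (s k r : nat) (al_F al_G ex_F ex_G : nat -> R) (mu : R) (N : nat).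
Hypotheses (ltsk : (s < 2 ^ k)%N) (n_le : (n <= N + s)%N) (mu0 : 0 <= mu).
Hypotheses (al_G1 : forall s, 1 <= al_G s) (ex_G1 : forall s, 1 <= ex_G s).
Hypotheses (al_F0 : 1 <= al_F 0%N) (al_Fge0 : forall s, 0 <= al_F s).
Hypothesis al_stepG : forall j, (j < s)%N -> al_G j <= al_G j.+1.
Hypothesis al_stepF :
  forall j, (j < s)%N -> al_F j * (1 + p * (al_G j - 1)) ^+ (N + j) <= al_F j.+1 * al_G j.
Hypothesis ex_F1 : forall s, 1 <= ex_F s.
Hypothesis ex_stepG : forall j, (j < s)%N -> (1 + p * mu) * ex_G j <= ex_G j.+1.
Hypothesis ex_stepF :
  forall j, (j < s)%N -> ex_F j * (1 + p * (ex_G j - 1)) ^+ (N + j) <= ex_F j.+1 * ex_G j.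

Let expl (H : {set {set 'I_n}}) v := explore (adj H) s [set v] (~: [set v]).

(* A large treedepth forces some exploration to be unfinished after s steps or
   to meet more than r closing edges. *)
Lemma Gnp_treedepth_gt : Gnp_prob p [pred G : sgraph 'I_n | (r + k < treedepth G)%N] <=
  n%:R * (al_F s * al_G s + ex_F s * ex_G s / (1 + mu) ^+ r.+1).
Proof.
have mu1 : 1 <= 1 + mu by rewrite lerDl.
have mp0 j : 0 < (1 + mu) ^+ j by rewrite exprn_gt0 // (lt_le_trans ltr01).
(* The first summand is the indicator of an unfinished exploration; the second is at least 1 once
   more than [r] closing edges occur. Summing over [v] is the union bound. *)
pose f H v := explore_weight 0 0 1 (expl H v) +
              (1 + mu) ^- r.+1 * explore_weight mu 1 0 (expl H v).
have f0 H v : 0 <= f H v.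
  rewrite /f; case: (expl H v) => [r'|] /=; rewrite ?mul0r ?add0r ?mulr0 ?addr0 ?mul1r //.
  by rewrite mulr_ge0 // ?invr_ge0 ltW.
apply: le_trans (Gnp_prob_le (f := fun H => \sum_v f H v) _ _) _.
- move=> G /= tdG; have e_irr : irreflexive (adj G) by move=> x; rewrite /adj /= eqxx.
  have [/forallP h|/forallPn[v]] :=
    boolP [forall v, if expl G v is Some r' then (r' <= r)%N else false].
    suff : (treedepth G <= r + k)%N by rewrite leqNgt tdG.
    apply: treedepth_ranked; apply: (ranked_closed_cover (@adj_sym _ G)) => v.
    have := h v; case ex: (expl G v) => [r'|] // r'r.
    have [C vC [Ccl rC]] := ranked_explore (@adj_sym _ G) e_irr ltsk ex.
    exists C => //; split=> //; apply: ranked_mono (subxx C) _ rC.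
    by rewrite leq_add2r.
  move=> nv; rewrite (bigD1 v) //= -[1]addr0 lerD ?sumr_ge0 // /f.
  case: (expl G v) nv => [r'|] /=; rewrite ?mulr0 ?addr0 // -ltnNge => rr'.
  rewrite mul0r add0r mul1r mulrC ler_pdivlMr // mul1r ler_weXn2l //.
- by move=> H; apply: sumr_ge0.
rewrite expect_sum mulr_natl -[n in _ *+ n]card_ord -sumr_const; apply: ler_sum => v _.
rewrite expectD expectZ; have dis : [disjoint [set v] & ~: [set v]].
  by rewrite disjoints_subset setCK.
have cn : (#|[set v]| + #|~: [set v]| <= N + s)%N by rewrite cardsC card_ord.
have vT : vpairs_in ([set v] :|: ~: [set v]) = vpairs 'I_n.
  by apply/setP=> e; rewrite setUCr !inE subsetT andbT.
have pmu : 0 <= p * mu by case/andP: p01 => p0 _; rewrite mulr_ge0.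
apply: lerD.
  have := @expect_explore _ p 'I_n p01 0 0 1 N s al_F al_G (lexx 0) (lexx 0) ler01 al_G1 al_Fge0 al_F0.
  move=> /(_ _ al_stepF s _ _ (leqnn s) dis cn); rewrite cards1 expr1 vT; apply.
  by move=> j js; rewrite mulr0 addr0 mul1r al_stepG.
rewrite [leRHS]mulrC ler_pM2l ?invr_gt0 //.
have ex0 : 0 <= ex_F 0%N by apply: le_trans ler01 (ex_F1 0).
have := @expect_explore _ p 'I_n p01 mu 1 0 N s ex_F ex_G mu0 ler01 (lexx 0) ex_G1 ex_F1 ex0.
by move=> /(_ ex_stepG ex_stepF s _ _ (leqnn s) dis cn); rewrite cards1 expr1 vT.
Qed.
End TreedepthUpperProb.

Lemma sum_expr_card (T : finType) (x : R) : \sum_(S : {set T}) x ^+ #|S| = (1 + x) ^+ #|T|.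
Proof.
rewrite addrC -prodr_const (eq_bigl xpredT) => [|i]; last by rewrite inE.
rewrite bigA_distr; apply: eq_bigr => S _.
by rewrite -prodr_const big_mkcond.
Qed.

(* Union bound over the separators S of treedepth_separator: at most s + L
   vertices of the complement of S are discovered in s steps.  The factor
   x ^- sig * (1 + x) ^+ n bounds the number of candidates for S. *)
Lemma Gnp_treedepth_le (K L sig s m : nat) (a x : R) :
    1 <= a -> 0 < x <= 1 -> (n * K < sig.+1 * L)%N -> (m + sig + s + L <= n)%N ->
  Gnp_prob p [pred G : sgraph 'I_n | (treedepth G <= K)%N] <=
  x ^- sig * (1 + x) ^+ n * (a ^+ (s + L) * ((1 + p * (a^-1 - 1)) ^+ m) ^+ s).
Proof.
move=> a1 /andP[x0 x1] hK hm; have a0 : 0 < a by apply: lt_le_trans a1.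
set q := (_ ^+ m) ^+ s.
pose phi k : R := a ^+ k * (m <= k)%:R.
(* Markov weight for a fixed [S]: at least 1 if at most [s + L] vertices off [S] are discovered. The
   cut-off at [m] in [phi] does no harm, since then at least [m] vertices stay undiscovered by
   [hm]. *)
pose g (S : {set 'I_n}) H := a ^+ (s + L) * a ^- #|~: S| * phi (unseen (adj H) s set0 (~: S)).
have dis (S : {set 'I_n}) : [disjoint set0 & ~: S] by rewrite -setI_eq0 set0I.
have g0 S H : 0 <= g S H.
  by rewrite /g /phi !mulr_ge0 ?invr_ge0 ?exprn_ge0 ?(ltW a0) //; case: (_ <= _)%N.
apply: le_trans (Gnp_prob_le (f := fun H => \sum_(S : {set 'I_n} | (#|S| <= sig)%N)
    g S (H :&: vpairs_in (~: S))) _ _) _.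
- move=> G /= tdG; have [S [l [cS le lL]]] := treedepth_separator G L.
  have Ssig : (#|S| <= sig)%N.
    rewrite -ltnS ltnNge; apply/negP=> hS; have := leq_trans hK (leq_mul hS (leqnn L)).
    rewrite ltnNge => /negP; apply; apply: leq_trans cS _.
    by rewrite card_ord leq_mul2l tdG orbT.
  rewrite (bigD1 S) //= -[1]addr0 lerD ?sumr_ge0 //.
  have sG := edgesP G.
  have eu : unseen (adj (edges G :&: vpairs_in (~: S))) s set0 (~: S) = unseen (adj G) s set0 (~: S).
    by apply: eq_unseen => // x' y'; rewrite set0U => hx hy; apply: adj_restrict.
  have hu : (#|~: S| <= unseen (adj G) s set0 (~: S) + s + L)%N.
    have := @unseen_ge _ _ l set0 L (adj G) s set0 (~: S) (dis S).
    rewrite cards0 add0n set0U; apply=> [x' y'|j|x'].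
    - by rewrite !inE; apply: le.
    - have [E|[z]] := set_0Vmem [set x' in ~: S | l x' == j]; first by rewrite E cards0.
      by rewrite inE => /andP[zS /eqP<-]; apply: lL; rewrite inE in zS.
    by rewrite inE.
  have cSn : (#|S| + #|~: S| = n)%N by rewrite cardsC card_ord.
  rewrite /g /phi eu; set u := unseen _ _ _ _ in hu *.
  have -> : (m <= u)%N by move: hu hm Ssig cSn; move: #|S| #|~: S| => S1 S2; lia.
  rewrite mulr1 mulrAC ler_pdivlMr ?exprn_gt0 // mul1r -exprD ler_weXn2l //.
  by rewrite addnC addnA.
- by move=> H; apply: sumr_ge0.
rewrite expect_sum; apply: le_trans (_ : \sum_(S : {set 'I_n} | (#|S| <= sig)%N) a ^+ (s + L) * q <= _).
  apply: ler_sum => S _; rewrite (expect_restrict (~: S) (g S)) expectZ -mulrA ler_wpM2l ?exprn_ge0 ?(ltW a0) //.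
  rewrite mulrC ler_pdivrMr ?exprn_gt0 // mulrC.
  by have := @expect_unseen _ p 'I_n p01 a m a1 s set0 (~: S) (dis S); rewrite set0U.
set Q := a ^+ (s + L) * q; under eq_bigr do rewrite -[Q]mul1r.
rewrite -mulr_suml ler_wpM2r // /Q.
  have /andP[p0 p1] := p01; have ai1 : a^-1 <= 1 by rewrite invf_le1.
  have ai0 : 0 <= a^-1 by rewrite invr_ge0 ltW.
  by rewrite mulr_ge0 // ?exprn_ge0 // ?(ltW a0) //; nra.
(* As x <= 1, every admissible S has x ^ sig <= x ^ #|S|, and the sum of x ^ #|S| over all sets is
   (1 + x) ^ n. *)
rewrite mulrC ler_pdivlMr ?exprn_gt0 // mulr_suml.
have := sum_expr_card 'I_n x; rewrite card_ord => <-.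
rewrite [leRHS](bigID (fun S : {set 'I_n} => #|S| <= sig)%N) /= -[leLHS]addr0 lerD ?sumr_ge0 //.
  by apply: ler_sum => S hS; rewrite mul1r ler_wiXn2l // ltW.
by move=> S _; rewrite exprn_ge0 // ltW.
Qed.

End GnpExpectation.

(** * Long paths by the second moment method *)

Section Paths.
Variable T : finType.
Implicit Types (s t : seq T) (H : {set {set T}}).

Fixpoint path_edges s : {set {set T}} :=
  if s is x :: s' then
    (if s' is y :: _ then [set [set x; y]] else set0) :|: path_edges s'
  else set0.

Lemma path_edges_cons x y s :
  path_edges (x :: y :: s) = [set x; y] |: path_edges (y :: s).
Proof. by []. Qed.

(** Sequences grow at the head. Starting from the empty sequence, a path is listed once per
    direction. *)
Fixpoint extensions j t : seq (seq T) :=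
  if j is j'.+1 then flatten [seq extensions j' (z :: t) | z <- enum T & z \notin t]
  else [:: t].

Lemma extensions_uniq j t s : uniq t -> s \in extensions j t -> uniq s /\ size s = size t + j.
Proof.
elim: j t => [|j IHj] t ut /=; first by rewrite inE addn0 => /eqP->.
case/flatten_mapP=> z; rewrite mem_filter => /andP[zt _] /IHj[|-> ->] //=; first by rewrite zt.
by rewrite addSnnS.
Qed.

Lemma sum_extensions (V : nmodType) j t (F : seq T -> V) :
  (\sum_(s <- extensions j.+1 t) F s = \sum_(z | z \notin t) \sum_(s <- extensions j (z :: t)) F s)%R.
Proof. by rewrite /= big_flatten big_map big_filter big_enum_cond. Qed.

(** The last of the [j] steps has the fewest choices: it must avoid [size t + j.-1] vertices. *)
Lemma extensions_size j t m : uniq t -> #|T| - m <= #|T| - size t - j.-1 ->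
  (#|T| - m) ^ j <= size (extensions j t).
Proof.
elim: j t => [|j IHj] t ut hm //.
have sz i t' : size (extensions i t') = (\sum_(s <- extensions i t') 1)%N by rewrite sum1_size.
rewrite sz sum_extensions expnS.
have ct : #|T| - size t <= #|[pred z | z \notin t]|.
  by have := cardC (mem t); rewrite (card_uniqP ut) => <-; rewrite addKn.
apply: leq_trans (_ : \sum_(z | z \notin t) (#|T| - m) ^ j <= _).
  rewrite sum_nat_const leq_mul2r; apply/orP; right; apply: leq_trans ct.
  by apply: leq_trans hm _; apply: leq_subr.
apply: leq_sum => z zt; rewrite -sz; case: j IHj hm => [|j] // IHj hm.
by apply: IHj; rewrite /= ?zt //; move: hm; rewrite /= !subnS => hm; lia.
Qed.

Lemma path_edges_in s x y : [set x; y] \in path_edges s -> x \in s.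
Proof.
elim: s => [|a [|b s] IHs]; first by rewrite inE.
  by rewrite /= setU0 inE.
rewrite path_edges_cons => /setU1P[/setP/(_ x)|/IHs xs]; last by rewrite inE xs orbT.
by rewrite !inE eqxx /= => /esym/orP[]->; rewrite ?orbT.
Qed.

Lemma path_edges_vpairs s : uniq s -> path_edges s \subset vpairs T.
Proof.
elim: s => [|a [|b s] IHs] us; [by rewrite sub0set | by rewrite /= setU0 sub0set|].
rewrite path_edges_cons subUset IHs; last by case/andP: us.
rewrite andbT sub1set inE cards2; have -> : a != b by move: us => /=; case: eqP => // ->; rewrite inE eqxx.
by [].
Qed.

Lemma path_edges_sorted s H : uniq s -> path_edges s \subset H -> sorted (adj H) s.
Proof.
elim: s => [|a [|b s] IHs] //; rewrite path_edges_cons subUset sub1set => us /andP[Hab sH].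
have /andP[/= nab us'] := us; rewrite /adj /= Hab andbT.
apply/andP; split; first by apply: contraNneq nab => ->; rewrite inE eqxx.
exact: IHs.
Qed.

(** The new edge contains the fresh vertex [x], so it differs from all older ones. *)
Lemma card_path_edgesD P x y s : x \notin y :: s ->
  #|path_edges (x :: y :: s) :\: P| = ([set x; y] \notin P) + #|path_edges (y :: s) :\: P|.
Proof.
move=> nx; rewrite path_edges_cons setDUl.
have nin : [set x; y] \notin path_edges (y :: s) by apply: contra nx; apply: path_edges_in.
have [xyP|xyP] := boolP ([set x; y] \in P).
  by have -> : [set [set x; y]] :\: P = set0 by [apply/eqP; rewrite setD_eq0 sub1set]; rewrite set0U.
have -> : [set [set x; y]] :\: P = [set [set x; y]].
  by apply/setDidPl; rewrite disjoints1.
by rewrite cardsU1 in_setD (negPf nin) andbF.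
Qed.

Lemma card_path_edges s : uniq s -> #|path_edges s| = (size s).-1.
Proof.
elim: s => [|a [|b s] IHs] us; [by rewrite cards0 | by rewrite /= setU0 cards0|].
have /andP[na us'] := us; have := card_path_edgesD set0 na.
by rewrite !setD0 in_set0 IHs // => ->.
Qed.

Definition path_nbrs s y := [set z | [set z; y] \in path_edges s].

Lemma path_nbrs_notin s y : y \notin s -> path_nbrs s y = set0.
Proof.
move=> ys; apply/setP=> z; rewrite !inE; apply/negbTE; apply: contra ys.
by rewrite setUC; apply: path_edges_in.
Qed.

Lemma path_nbrs_cons a b s y : path_nbrs (a :: b :: s) y =
  (if y == a then [set b] else if y == b then [set a] else set0) :|: path_nbrs (b :: s) y.
Proof.
apply/setP=> z; rewrite in_setU ![z \in path_nbrs _ _]in_set path_edges_cons in_setU1.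
congr (_ || _).
apply/eqP/idP=> [e|]; last first.
  by case: eqP => [-> /set1P->|_]; [rewrite setUC | case: eqP => [-> /set1P->|]; rewrite ?inE].
have /set2P hz : z \in [set a; b] by rewrite -e set21.
have /set2P hy : y \in [set a; b] by rewrite -e set22.
have /set2P ha : a \in [set z; y] by rewrite e set21.
have /set2P hb : b \in [set z; y] by rewrite e set22.
case: (eqVneq y a) => [ya|/eqP ya]; last case: (eqVneq y b) => [yb|/eqP yb]; rewrite ?inE.
- by apply/eqP; case: hz hb => -> // [->|->].
- by apply/eqP; case: ha => // /esym.
by case: hy.
Qed.

Lemma card_path_nbrs_head a s : uniq (a :: s) -> #|path_nbrs (a :: s) a| <= 1.
Proof.
case: s => [|b s] us.
  by rewrite /path_nbrs /= setU0; under eq_finset do rewrite inE; rewrite cards0.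
have /andP[na _] := us.
by rewrite path_nbrs_cons eqxx (path_nbrs_notin na) setU0 cards1.
Qed.

Lemma card_path_nbrs s y : uniq s -> #|path_nbrs s y| <= 2.
Proof.
elim: s => [|a [|b s] IHs] us.
- by rewrite /path_nbrs /=; under eq_finset do rewrite inE; rewrite cards0.
- by rewrite /path_nbrs /= setU0; under eq_finset do rewrite inE; rewrite cards0.
have /andP[na us'] := us; rewrite path_nbrs_cons.
case: eqP => [->|_]; first by rewrite (path_nbrs_notin na) setU0 cards1.
case: eqP => [->|_]; last by rewrite set0U IHs.
apply: leq_trans (leq_card_setU _ _) _; rewrite cards1 (leq_add2l 1).
exact: card_path_nbrs_head.
Qed.

End Paths.

(** * Expected number of paths, given a fixed path *)

Section PathWeights.
Local Open Scope ring_scope.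
Variables (R : realFieldType) (p : R) (T : finType).
Variables (s0 : seq T).
Let k := size s0.
Let n := #|T|.
Let c := n%:R * p.
Let P := path_edges s0.
Hypotheses (us0 : uniq s0) (p0 : 0 <= p) (c1 : c <= 1) (k_small : (4 * k ^ 3 <= n)%N).

(** Conditional probability that all edges of [s] are present, given those of [s0]. *)
Let pd s : R := p ^+ #|path_edges s :\: P|.
(** The three bounds refer to the newest vertex: off [s0], arbitrary, or just reached along an edge
    of [s0]. In [off_bound] the second term accounts for hitting one of the k vertices of [s0] in
    one of j steps, at cost p, with [on_bound] at most 4 k afterwards. *)
Let off_bound j : R := c ^+ j + (4 * k * j)%:R * (p * k%:R).
Let on_bound j : R := (4 * j + 1)%:R.
Let along_bound j : R := (2 * j + 1)%:R.

Lemma off_bound_le2 j : (j <= k)%N -> off_bound j <= 2.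
Proof.
move=> jk; rewrite /off_bound -[2]/(1 + 1); apply: lerD.
  by rewrite exprn_ile1 // /c mulr_ge0.
apply: le_trans (_ : (4 * k ^ 3)%:R * p <= 1).
  rewrite mulrCA [leRHS]mulrC ler_wpM2l // -natrM ler_nat !expnS expn0 muln1 -!mulnA.
  by rewrite leq_mul2l /= leq_mul2l leq_mul2r jk !orbT.
apply: le_trans c1; rewrite /c ler_wpM2r // ler_nat //.
Qed.

(* A second path t is built vertex by vertex; a step costs a factor p unless it
   follows the path s0.  There are two ways to enter an edge of s0 from a vertex
   of s0, but only one to go on along s0. *)
Lemma sum_extensions_weight j y t : uniq (y :: t) -> (j <= k)%N ->
  let S := \sum_(s <- extensions j (y :: t)) pd s in
  [/\ y \notin s0 -> S <= pd (y :: t) * off_bound j,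
      S <= pd (y :: t) * on_bound j &
      forall x t', t = x :: t' -> [set y; x] \in P -> S <= pd (y :: t) * along_bound j].
Proof.
have pd0 s : 0 <= pd s by rewrite exprn_ge0.
elim: j y t => [|j IHj] y t ut jk /=.
  rewrite big_seq1; split=> *; rewrite ler_peMr // /off_bound /on_bound /along_bound ?expr0 ?muln0 //.
  by rewrite mul0r addr0.
have jk' : (j <= k)%N by apply: ltnW.
have c0 : 0 <= c by rewrite mulr_ge0.
have off2 := off_bound_le2 jk.
have off0 i : 0 <= off_bound i by rewrite addr_ge0 ?exprn_ge0 ?mulr_ge0.
have on0 i : 0 <= on_bound i by [].
have along0 i : 0 <= along_bound i by [].
pose cs := [set z in path_nbrs s0 y | z \notin y :: t]; pose cnt := #|cs|.
have csE z : (z \in cs) = (z \in path_nbrs s0 y) && (z \notin y :: t) by rewrite /cs in_set.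
have key : \sum_(s <- extensions j.+1 (y :: t)) pd s <=
    pd (y :: t) * (off_bound j.+1 + cnt%:R * along_bound j).
  rewrite sum_extensions.
  pose bd z := pd (y :: t) * (p * (off_bound j + (z \in s0)%:R * on_bound j) +
     (z \in cs)%:R * along_bound j).
  apply: le_trans (_ : \sum_(z | z \notin y :: t) bd z <= _).
    apply: ler_sum => z zt; have uzt : uniq (z :: y :: t) by rewrite /= zt.
    have [h1 h2 h3] := IHj z (y :: t) uzt jk'.
    have pdz : pd (z :: y :: t) = p ^+ ([set z; y] \notin P) * pd (y :: t).
      by rewrite /pd card_path_edgesD // exprD.
    rewrite /bd csE zt andbT inE -/P; case: (boolP ([set z; y] \in P)) => zyP.
      have := h3 y t erefl zyP; rewrite pdz zyP expr0 mul1r => /le_trans; apply.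
      rewrite ler_wpM2l // mul1r lerDr mulr_ge0 // addr_ge0 // mulr_ge0 //.
    rewrite mul0r addr0; move: h1 h2; rewrite pdz zyP expr1 /= => h1 h2.
    rewrite mulrA [pd _ * p]mulrC; case: (boolP (z \in s0)) => zs0.
      by apply: le_trans h2 _; rewrite ler_wpM2l ?mulr_ge0 // mul1r lerDr.
    by apply: le_trans (h1 zs0) _; rewrite ler_wpM2l ?mulr_ge0 // mul0r addr0.
  apply: le_trans (_ : \sum_z bd z <= _).
    rewrite [leRHS](bigID (fun z => z \notin y :: t)) /= lerDl sumr_ge0 // => z _.
    by rewrite /bd mulr_ge0 // addr_ge0 // mulr_ge0 // addr_ge0 // mulr_ge0.
  rewrite -big_distrr /= ler_wpM2l // big_split /= -big_distrr /= big_split /= -!big_distrl /=.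
  apply: lerD; last first.
    rewrite ler_wpM2r // -natr_sum ler_nat /cnt -sum1_card [leqRHS]big_mkcond.
    by apply: leq_sum => z _; case: (_ \in cs).
  rewrite sumr_const -natr_sum -/n.
  have -> : (\sum_z (z \in s0) = k)%N.
    by rewrite /k -(card_uniqP us0) -sum1_card [RHS]big_mkcond; apply: eq_bigr => z _; case: (_ \in _).
  have -> : p * (off_bound j *+ n + k%:R * on_bound j) = c * off_bound j + (p * k%:R) * on_bound j.
    by rewrite mulrDr [p * (_ * _)]mulrA -[off_bound j *+ n]mulr_natl mulrA [p * n%:R]mulrC.
  have d0 : 0 <= p * k%:R by rewrite mulr_ge0.
  rewrite {1}/off_bound mulrDr -exprS -addrA /off_bound lerD2l.
  apply: le_trans (_ : (4 * k * j)%:R * (p * k%:R) + p * k%:R * on_bound j <= _).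
    by rewrite lerD2r ler_piMl ?mulr_ge0.
  rewrite [X in _ + X]mulrC -mulrDl ler_wpM2r // /on_bound -natrD ler_nat.
  by rewrite mulnS addnC leq_add2r addn1 -(@ltn_pmul2l 4) // in jk *.
have cnt2 : (cnt <= 2)%N.
  apply: leq_trans (card_path_nbrs y us0); apply/subset_leq_card/subsetP=> z.
  by rewrite csE => /andP[].
have fin b : off_bound j.+1 + cnt%:R * along_bound j <= b ->
    \sum_(s <- extensions j.+1 (y :: t)) pd s <= pd (y :: t) * b.
  by move=> le_b; apply: le_trans key _; rewrite ler_wpM2l.
split=> [ys0||x t' et yxP]; apply: fin.
- have -> : cnt = 0%N.
    by apply/eqP; rewrite cards_eq0 -subset0; apply/subsetP=> z; rewrite csE path_nbrs_notin // inE.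
  by rewrite mul0r addr0.
- apply: le_trans (_ : 2 + 2 * along_bound j <= _).
    by rewrite lerD // ler_wpM2r // (ler_nat R cnt 2).
  by rewrite /along_bound /on_bound -natrM -natrD ler_nat; lia.
(* The path came along [s0] from [x], so one of the at most two neighbours of [y] is used up. *)
have cnt1 : (cnt <= 1)%N.
  have xN : x \in path_nbrs s0 y by rewrite inE setUC.
  rewrite -ltnS; apply: leq_trans (card_path_nbrs y us0).
  apply: proper_card; apply/properP; split.
    by apply/subsetP=> z; rewrite csE => /andP[].
  by exists x => //; rewrite csE et !inE eqxx !orbT andbF.
apply: le_trans (_ : 2 + 1 * along_bound j <= _).
  by rewrite lerD // ler_wpM2r // (ler_nat R cnt 1).
by rewrite /along_bound mul1r -natrD ler_nat; lia.
Qed.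
End PathWeights.

Section LongPath.
Local Open Scope ring_scope.

(** Bernoulli's inequality for (1 - y / x) ^ i, cleared of denominators. *)
Lemma subn_expr_ge (R : realDomainType) (x y : R) i :
  0 <= y <= x -> x ^+ i * (x - i%:R * y) <= x * (x - y) ^+ i.
Proof.
move=> /andP[y0 yx]; elim: i => [|i IHi]; first by rewrite mul0r subr0 !expr0 mul1r mulr1.
have xy0 : 0 <= x - y by rewrite subr_ge0.
have x0 : 0 <= x by apply: le_trans yx.
rewrite [X in _ <= _ * X]exprSr mulrA; apply: le_trans (ler_wpM2r xy0 IHi).
rewrite exprSr -!mulrA ler_wpM2l ?exprn_ge0 //.
have i0 : (0 : R) <= i%:R by [].
rewrite -natr1; nra.
Qed.

(** The left side is the variance over the squared mean. In the application [M] bounds the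
    conditional mean of [X] given one of the counted paths. *)
Lemma chebyshev_expect (R : realFieldType) (p : R) (I : finType) (D : {set I})
    (X : {set I} -> R) (M : R) :
    0 <= p <= 1 -> expect p D (fun H => X H ^+ 2) <= expect p D X * M ->
    0 < expect p D X ->
  expect p D (fun H => (X H - expect p D X) ^+ 2 / expect p D X ^+ 2) <=
  M / expect p D X - 1.
Proof.
move=> p01; set m := expect p D X => X2 m0.
rewrite (eq_expect p (g := fun H => m ^- 2 * (X H ^+ 2 + ((- 2 * m) * X H + m ^+ 2 * 1)))); last first.
  by move=> H _; rewrite mulrC; congr (_ * _); ring.
rewrite expectZ expectD expectD !expectZ expect1 mulr1 -/m.
rewrite mulrC ler_pdivrMr ?exprn_gt0 //.
have -> : (M / m - 1) * m ^+ 2 = m * M - m ^+ 2 by field; rewrite gt_eqF.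
by rewrite addrA; nra.
Qed.

Variables (R : realType) (p : R) (n k' : nat).
Let k := k'.+1.
Let c := n%:R * p.
Hypotheses (p_gt0 : 0 < p) (p_le1 : p <= 1) (c1 : c <= 1).
Hypotheses (kn3 : (4 * k ^ 3 <= n)%N) (kn2 : (2 * k ^ 2 <= n)%N).

Let paths := extensions k ([::] : seq 'I_n).
Let X (H : {set {set 'I_n}}) : R := \sum_(s <- paths) (path_edges s \subset H)%:R.
Let m := expect p (vpairs 'I_n) X.

Let pathsP s : s \in paths -> uniq s /\ size s = k.
Proof. by move/extensions_uniq => /(_ isT). Qed.

Lemma expect_npathsE : m = (size paths)%:R * p ^+ k'.
Proof.
rewrite /m /X expect_sum big_seq (eq_bigr (fun=> p ^+ k')) => [|s /pathsP[us ss]].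
  by rewrite -big_seq big_const_seq count_predT iter_addr addr0 mulr_natl.
by rewrite expect_sub ?path_edges_vpairs // card_path_edges // ss.
Qed.

Lemma expect_npaths_ge : c ^+ k' * (n%:R - k%:R * k%:R) <= m.
Proof.
have n0 : (0 < n)%N by apply: leq_trans kn2; rewrite muln_gt0 expn_gt0.
have kn : (k <= n)%N by apply: leq_trans kn2; rewrite expnS expn1 mulnA leq_pmull.
have hN : ((n - k) ^ k <= size paths)%N.
  have := @extensions_size 'I_n k [::] k isT; rewrite card_ord subn0; apply.
  by apply: leq_sub2l; apply: leq_pred.
have h1 : n%:R ^+ k * (n%:R - k%:R * k%:R) <= n%:R * (size paths)%:R :> R.
  apply: le_trans (subn_expr_ge k _) _; first by rewrite ler0n ler_nat.
  by rewrite ler_wpM2l // -natrB // -natrX ler_nat.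
rewrite expect_npathsE /c exprMn -(@ler_pM2l _ n%:R) ?ltr0n //.
rewrite [leRHS]mulrA; apply: le_trans (ler_wpM2r (exprn_ge0 k' (ltW p_gt0)) h1).
by rewrite exprS -!mulrA ler_wpM2l // ler_wpM2l ?exprn_ge0 // mulrC.
Qed.

Lemma half_le_subn_sqr : n%:R / 2 <= n%:R - k%:R * k%:R :> R.
Proof.
have : (2 * k ^ 2)%:R <= n%:R :> R by rewrite ler_nat.
by rewrite natrM natrX expr2; lra.
Qed.

Lemma expect_npaths_gt0 : 0 < m.
Proof.
have n0 : (0 < n)%N by apply: leq_trans kn2; rewrite muln_gt0 expn_gt0.
apply: lt_le_trans expect_npaths_ge; rewrite mulr_gt0 ?exprn_gt0 //.
  by rewrite /c mulr_gt0 // ltr0n.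
by apply: lt_le_trans half_le_subn_sqr; rewrite divr_gt0 ?ltr0n.
Qed.

(** Given one path, second paths with a fixed start off it contribute at most c ^ k' + 4 k ^ 2 k' p,
    and those with a fixed start on it at most 4 k' + 1. Over n starts, of which k lie on the path,
    the surplus above n c ^ k' stays below 8 k ^ 3, using c <= 1. *)
Lemma expect_npaths_sqr : expect p (vpairs 'I_n) (fun H => X H ^+ 2) <=
  m * (n%:R * c ^+ k' + (8 * k ^ 3)%:R).
Proof.
have p0 := ltW p_gt0.
rewrite (eq_expect p (g := fun H => \sum_(s <- paths) \sum_(t <- paths)
   (path_edges s :|: path_edges t \subset H)%:R)); last first.
  move=> H _; rewrite expr2 /X mulr_suml; apply: eq_bigr => s _.
  by rewrite mulr_sumr; apply: eq_bigr => t _; rewrite subUset -natrM mulnb.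
rewrite expect_sum expect_npathsE mulrAC mulr_natl -[(size _)]sum1_size natr_sum.
rewrite -mulrA mulr_suml big_seq [leRHS]big_seq; apply: ler_sum => s /pathsP[us ss].
rewrite mul1r expect_sum.
apply: le_trans (_ : \sum_(t <- paths) p ^+ k' * p ^+ #|path_edges t :\: path_edges s| <= _).
  rewrite big_seq [leRHS]big_seq; apply: ler_sum => t /pathsP[ut st].
  rewrite expect_sub; last by rewrite subUset !path_edges_vpairs.
  have sk : k' = #|path_edges s| by rewrite card_path_edges // ss.
  rewrite -exprD sk cardsU cardsD [path_edges t :&: _]setIC addnBA //.
  by apply/subset_leq_card/subsetIr.
rewrite -mulr_sumr mulrC ler_wpM2r ?exprn_ge0 // /paths sum_extensions.
have c1' : #|'I_n|%:R * p <= 1 by rewrite card_ord.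
have ks : (4 * size s ^ 3 <= #|'I_n|)%N by rewrite card_ord ss.
have kk : (k' <= size s)%N by rewrite ss.
pose OFF := c ^+ k' + (4 * k * k')%:R * (p * k%:R).
pose ON : R := (4 * k' + 1)%:R.
have ON0 : 0 <= ON by [].
have OFF0 : 0 <= OFF by rewrite addr_ge0 ?mulr_ge0 // exprn_ge0 // /c mulr_ge0.
apply: le_trans (_ : \sum_(z : 'I_n) (OFF + (z \in s)%:R * ON) <= _).
  rewrite [leLHS]big_mkcond /=; apply: ler_sum => z _.
  have [h1 h2 _] := sum_extensions_weight us p0 c1' ks (isT : uniq [:: z]) kk.
  have pd1 : p ^+ #|path_edges [:: z] :\: path_edges s| = 1.
    by rewrite /= setU0 set0D cards0.
  move: h1 h2; rewrite pd1 !mul1r card_ord ss => h1 h2.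
  case: (boolP (z \in s)) => zs; last by rewrite mul0r addr0; apply: h1.
  by apply: le_trans h2 _; rewrite mul1r lerDr.
rewrite big_split /= sumr_const card_ord -mulr_suml -natr_sum.
have -> : (\sum_z (z \in s) = k)%N.
  by rewrite -ss -(card_uniqP us) -sum1_card [RHS]big_mkcond; apply: eq_bigr => z _; case: (_ \in _).
rewrite /OFF mulrnDl -addrA lerD2l -[X in X + _]mulr_natl.
have -> : n%:R * ((4 * k * k')%:R * (p * k%:R)) = c * ((4 * k * k' * k)%:R).
  by rewrite /c !natrM; ring.
apply: le_trans (_ : (4 * k * k' * k)%:R + k%:R * ON <= _).
  by rewrite lerD2r ler_piMl.
rewrite /ON -natrM -natrD ler_nat /k; lia.
Qed.

(** Chebyshev's inequality at X = 0. The mean is at least c ^ k' (n - k ^ 2), hence at least c ^ k'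
    n / 2; it falls short of the conditional mean by at most 9 k ^ 3, and the quotient gives the
    factor 18. *)
Lemma Gnp_short_paths :
  Gnp_prob p [pred G : sgraph 'I_n | (2 ^ treedepth G <= k)%N] <=
  (18 * k ^ 3)%:R / (c ^+ k' * n%:R).
Proof.
have p01 : 0 <= p <= 1 by rewrite ltW.
have n0 : (0 < n)%N by apply: leq_trans kn2; rewrite muln_gt0 expn_gt0.
have q0 : 0 < c ^+ k' * n%:R by rewrite mulr_gt0 ?ltr0n // exprn_gt0 // /c mulr_gt0 // ltr0n.
have m0 := expect_npaths_gt0.
apply: le_trans (Gnp_prob_le p01 (f := fun H => (X H - m) ^+ 2 / m ^+ 2) _ _) _.
- move=> G /= tdG; have -> : X (edges G) = 0.
    rewrite /X big_seq big1 // => s /pathsP[us ss]; case: (boolP (_ \subset _)) => // sG.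
    have := path_size_treedepth us (path_edges_sorted us sG).
    by rewrite ss ltnNge tdG.
  by rewrite sub0r sqrrN mulfV // expf_neq0 // gt_eqF.
- by move=> H; rewrite divr_ge0 ?sqr_ge0.
apply: le_trans (chebyshev_expect p01 expect_npaths_sqr m0) _.
rewrite -/m; have hm := expect_npaths_ge; have hn := half_le_subn_sqr.
have qp : 0 < c ^+ k' by rewrite exprn_gt0 // /c mulr_gt0 // ltr0n.
have q1 : c ^+ k' <= 1 by rewrite exprn_ile1 // /c mulr_ge0 // ltW.
move: q0 qp q1 hm hn m0; move: (c ^+ k') => q q0 qp q1 hm hn m0.
rewrite [(8 * _)%:R]natrM [(18 * _)%:R]natrM natrX.
set K := k%:R in hm hn *; set N := n%:R in q0 hm hn *.
have K1 : 1 <= K by rewrite /K ler1n.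
have -> : (N * q + 8 * K ^+ 3) / m - 1 = (N * q + 8 * K ^+ 3 - m) / m.
  by field; rewrite gt_eqF.
have hm2 : q * N / 2 <= m by nra.
rewrite ler_pdivrMr // mulrAC ler_pdivlMr //.
have K3 : K * K <= K ^+ 3 by rewrite exprS expr2; nra.
have h9 : N * q + 8 * K ^+ 3 - m <= 9 * K ^+ 3 by nra.
apply: le_trans (ler_wpM2r (ltW q0) h9) _.
have K30 : 0 <= K ^+ 3 by rewrite exprn_ge0 // (le_trans ler01).
nra.
Qed.
End LongPath.

Lemma treedepth_le_card (T : finType) (G : sgraph T) : treedepth G <= #|T|.
Proof.
apply: treedepth_ranked; rewrite -cardsT -[#|_|]addn0; apply: ranked_remove.
by exists (fun=> 0); rewrite setDv; split=> x; rewrite inE.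
Qed.

From mathcomp Require Import all_classical all_reals all_analysis.
Import numFieldNormedType.Exports.

(** * Asymptotics *)

Section Asymptotics.
Local Open Scope ring_scope.
Variable R : realType.
Implicit Types (x y : R) (n : nat).

Lemma ln_nat_ge y : exists N, forall n, (N <= n)%N -> y <= ln (n%:R : R).
Proof.
exists (Num.truncn (expR y)).+1 => n hn; rewrite -[y]expRK ler_ln ?posrE ?expR_gt0 //.
  by apply: ltW; apply: lt_le_trans (truncnS_gt _) _; rewrite ler_nat.
by rewrite ltr0n; apply: leq_trans hn.
Qed.

(** A common error rate C / ln n reduces every regime to inequalities for fixed n, with the
    threshold X0 measured on the scale of ln n. *)
Lemma aas_treedepth_rate (p f : nat -> R) (a b C X0 : R) : 0 < a -> a <= b ->
    (forall n, X0 <= ln n%:R -> 0 <= p n <= 1 /\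
       1 - C / ln n%:R <= Gnp_prob (p n) [pred G : sgraph 'I_n |
           (a * f n <= (treedepth G)%:R) && ((treedepth G)%:R <= b * f n)]) ->
  aas_treedepth_Theta p f.
Proof.
move=> a0 ab h; exists a, b; split=> //; apply/cvgrPdist_le => e e0.
have [N hN] := ln_nat_ge (Num.max X0 (Num.max 1 (`|C| / e))).
exists N => // n /= /hN; rewrite !ge_max => /and3P[/h[p01 hn] l1 lC].
have l0 : 0 < ln (n%:R : R) by apply: lt_le_trans l1.
rewrite ger0_norm ?subr_ge0 ?Gnp_prob_le1 // lerBlDr addrC -lerBlDr.
apply: le_trans hn; rewrite lerD2l lerN2 ler_pdivrMr //.
by apply: le_trans (ler_norm C) _; rewrite -ler_pdivrMl // mulrC.
Qed.

Lemma expR_natM n x : expR (n%:R * x) = expR x ^+ n.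
Proof. by rewrite expRM_natl. Qed.

Lemma le_expr_expR x y n : 0 <= x -> x <= expR y -> x ^+ n <= expR (n%:R * y).
Proof. by move=> x0 xy; rewrite expR_natM lerXn2r // nnegrE expR_ge0. Qed.

Lemma expr_ln x n : 0 < x -> x ^+ n = expR (n%:R * ln x).
Proof. by move=> x0; rewrite expR_natM lnK. Qed.

Lemma expRN_le_inv x : 0 < x -> expR (- x) <= x^-1.
Proof.
move=> x0; rewrite expRN lef_pV2 ?posrE ?expR_gt0 //.
by apply: le_trans (expR_ge1Dx x); rewrite lerDr.
Qed.

(** * The case c > 1 *)

Section Supercritical.
Variable c : R.
Hypothesis c1 : 1 < c.

(** Undiscovered vertices get weight 1 + th; a step then gains exp (- th rho m / n) against a cost
    of exp th, and rho > 1. The fractions [tau], [dl], [eta] of n give the steps, the component size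
    and the separator size. Each is at most tau, so m / n is at least 1 - 3 tau, and rho (1 - 3 tau)
    = (1 + rho) / 2. [beta] makes the net gain about 8 beta n, while [eta], [x] and [dl] keep each
    of three costs below beta n. *)
Let th := (c - 1) / 2.
Let rho := c / (1 + th).
Let tau := (rho - 1) / (6 * rho).
Let beta := th * tau * (rho - 1) / 16.
Let x := Num.min beta 1.
Let l := - ln x.
Let dl := Num.min (beta / th) tau.
Let eta := Num.min (beta / (l + 1)) tau.

Let th0 : 0 < th. Proof. by rewrite /th; move: c1; lra. Qed.

Let rho1 : 1 < rho.
Proof. by rewrite /rho ltr_pdivlMr; move: th0; rewrite /th; lra. Qed.

Let tau0 : 0 < tau.
Proof. by rewrite /tau divr_gt0; move: rho1; lra. Qed.

Let beta0 : 0 < beta.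
Proof. by rewrite /beta divr_gt0 // mulr_gt0 ?subr_gt0 // mulr_gt0. Qed.

Let x0 : 0 < x. Proof. by rewrite /x lt_min beta0 ltr01. Qed.

Let l0 : 0 <= l.
Proof. by rewrite /l oppr_ge0 ln_le0 // /x ge_min lexx orbT. Qed.

Let dl0 : 0 < dl. Proof. by rewrite /dl lt_min tau0 divr_gt0. Qed.

Let eta0 : 0 < eta.
Proof. by rewrite /eta lt_min tau0 divr_gt0 //; move: l0; lra. Qed.

Let rho_tau : rho * (1 - 3 * tau) = (1 + rho) / 2.
Proof. by rewrite /tau; field; move: rho1; lra. Qed.

Let tau16 : tau <= 1 / 6.
Proof. by rewrite /tau ler_pdivrMr; move: rho1; lra. Qed.

Lemma supercritical_bound n K L sig s :
  let N := n%:R : R in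
    (n * K < sig.+1 * L)%N -> (sig + s + L <= n)%N -> c <= N ->
    tau * N - 1 <= s%:R <= tau * N -> L%:R <= dl * N -> sig%:R <= eta * N ->
  Gnp_prob (c / N) [pred G : sgraph 'I_n | (treedepth G <= K)%N] <=
  expR (- (beta * N) + th * rho).
Proof.
move=> N hK hn cN /andP[s_ge s_le] L_le sig_le.
have N0 : 0 < N by apply: lt_le_trans cN; move: c1; lra.
have p01 : 0 <= c / N <= 1.
  by rewrite ler_pdivrMr // mul1r cN divr_ge0 // ltW //; move: c1; lra.
pose m := (n - (sig + s + L))%N.
have hm : (m + sig + s + L <= n)%N by rewrite -!addnA [(sig + _)%N]addnA subnK.
have a1 : 1 <= 1 + th by rewrite lerDl ltW.
have x01 : 0 < x <= 1 by rewrite x0 /x ge_min lexx orbT.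
apply: le_trans (Gnp_treedepth_le p01 a1 x01 hK hm) _.
have e1 : x ^- sig <= expR (sig%:R * l).
  by rewrite /l mulrN expRN -expr_ln.
have e2 : (1 + x) ^+ n <= expR (N * x).
  by apply: le_expr_expR; [rewrite addr_ge0 // ltW | apply: expR_ge1Dx].
have e3 : (1 + th) ^+ (s + L) <= expR ((s + L)%:R * th).
  by apply: le_expr_expR; [rewrite addr_ge0 // ltW | apply: expR_ge1Dx].
pose q := 1 + c / N * ((1 + th)^-1 - 1).
have th10 : 0 < 1 + th by move: th0; lra.
have q0 : 0 <= q.
  case/andP: p01 => h1 h2; have : 0 <= (1 + th)^-1 <= 1.
    by rewrite invr_ge0 ltW //= invf_le1.
  by rewrite /q; nra.
have e4 : (q ^+ m) ^+ s <= expR (s%:R * (m%:R * (c / N * ((1 + th)^-1 - 1)))).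
  rewrite expR_natM lerXn2r ?nnegrE ?expR_ge0 ?exprn_ge0 //.
  by apply: le_expr_expR => //; apply: expR_ge1Dx.
apply: le_trans (_ : expR (sig%:R * l) * expR (N * x) * (expR ((s + L)%:R * th) *
    expR (s%:R * (m%:R * (c / N * ((1 + th)^-1 - 1))))) <= _).
  apply: ler_pM; rewrite ?mulr_ge0 ?invr_ge0 ?exprn_ge0 ?(ltW x0) //; first by rewrite addr_ge0 // ltW.
  - by rewrite ltW.
  - by apply: ler_pM => //; rewrite ?invr_ge0 ?exprn_ge0 ?addr_ge0 ?ltW.
  by apply: ler_pM => //; rewrite ?exprn_ge0 // ltW.
rewrite -!expRD ler_expR.
have -> : s%:R * (m%:R * (c / N * ((1 + th)^-1 - 1))) = - (th * rho * (m%:R / N) * s%:R).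
  by rewrite /rho; field; rewrite !gt_eqF.
have mN : 1 - 3 * tau <= m%:R / N.
  rewrite ler_pdivlMr // /m natrB // !natrD.
  have h1 : dl <= tau by rewrite /dl ge_min lexx orbT.
  have h2 : eta <= tau by rewrite /eta ge_min lexx orbT.
  by rewrite -/N; nra.
have b1 : eta * l <= beta.
  have h : eta <= beta / (l + 1) by rewrite /eta ge_min lexx.
  have l10 : 0 < l + 1 by move: l0; lra.
  move: h; rewrite ler_pdivlMr // => h; move: eta0 l0; nra.
have b2 : dl * th <= beta.
  have : dl <= beta / th by rewrite /dl ge_min lexx.
  by rewrite ler_pdivlMr.
have b3 : x <= beta by rewrite /x ge_min lexx.
have bb : th * tau * (rho - 1) = 16 * beta by rewrite /beta; field.
rewrite natrD.
have s0 : 0 <= s%:R :> R by [].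
have t1 : sig%:R * l <= beta * N.
  apply: le_trans (_ : eta * N * l <= _); first by rewrite ler_wpM2r.
  by rewrite mulrAC ler_wpM2r // ltW.
have t2 : N * x <= beta * N by rewrite mulrC ler_wpM2r // ltW.
have t3 : L%:R * th <= beta * N.
  apply: le_trans (_ : dl * N * th <= _); first by rewrite ler_wpM2r // ltW.
  by rewrite mulrAC ler_wpM2r // ltW.
have t4 : th * ((1 + rho) / 2) * s%:R <= th * rho * (m%:R / N) * s%:R.
  rewrite -rho_tau ler_wpM2r // mulrA ler_wpM2l // mulr_ge0 ?ltW //.
  by move: rho1; lra.
(* [s] may fall short of [tau * N] by 1; this loss is covered by the summand [th * rho] of the
   exponent. *)
have t5 : th * ((rho - 1) / 2) * (tau * N - 1) <= th * ((rho - 1) / 2) * s%:R.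
  by rewrite ler_wpM2l // mulr_ge0 ?ltW // divr_gt0 // subr_gt0.
have t6 : th * ((rho - 1) / 2) * (tau * N - 1) = 8 * beta * N - th * ((rho - 1) / 2).
  have -> : th * ((rho - 1) / 2) * (tau * N - 1) =
     th * tau * (rho - 1) / 2 * N - th * ((rho - 1) / 2) by field.
  by rewrite bb; field.
have t7 : 0 < beta * N by rewrite mulr_gt0.
have t8 : 0 < th * (rho + 1) by rewrite mulr_gt0 //; move: rho1; lra.
have t9 : th * ((rho - 1) / 2) = th * rho - th * (rho + 1) / 2 by field.
have t10 : th * ((1 + rho) / 2) * s%:R = th * s%:R + th * ((rho - 1) / 2) * s%:R by field.
lra.
Qed.

Lemma supercritical_aas :
  aas_treedepth_Theta (fun n => c / n%:R) (fun n => n%:R).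
Proof.
(* One factor 2 pays for rounding [L] down, as [dl * N] is at least 2; the other makes the
   inequality [hK] strict. *)
pose a := eta * dl / 4.
have a0 : 0 < a by rewrite divr_gt0 ?mulr_gt0.
have dt : dl <= tau by rewrite /dl ge_min lexx orbT.
have et : eta <= tau by rewrite /eta ge_min lexx orbT.
have a1 : a <= 1 by move: eta0 dl0 tau16; rewrite /a; nra.
pose C := expR (th * rho) / beta.
pose X0 := Num.max 1 (Num.max c (Num.max (2 / dl) (1 / tau))).
apply: (@aas_treedepth_rate _ _ a 1 C X0) => // n hX.
set N : R := n%:R in hX *.
have X1 : 1 <= ln N by apply: le_trans hX; rewrite /X0 le_max lexx.
have N0 : 0 < N.
  by rewrite ltNge; apply: contraTN X1 => /ln0 ->; rewrite -ltNge ltr01.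
have lnN : ln N <= N.
  by rewrite -[X in _ <= X]lnK ?posrE //; apply: le_trans (expR_ge1Dx _); rewrite lerDr.
have : X0 <= N by apply: le_trans lnN.
rewrite !ge_max => /and4P[N1 cN dN tN].
have p01 : 0 <= c / N <= 1.
  by rewrite ler_pdivrMr // mul1r cN divr_ge0 // ltW //; move: c1; lra.
split=> //.
pose s := Num.truncn (tau * N); pose L := Num.truncn (dl * N).
pose sig := Num.truncn (eta * N); pose K := Num.truncn (a * N).
have tr y : 0 <= y -> (Num.truncn y)%:R <= y /\ y - 1 <= (Num.truncn y)%:R.
  move=> y0; split; first by rewrite truncn_le.
  by rewrite lerBlDr natr1; apply/ltW/truncnS_gt.
have [s1 s2] := tr (tau * N) (ltW (mulr_gt0 tau0 N0)).
have [L1 L2] := tr (dl * N) (ltW (mulr_gt0 dl0 N0)).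
have [g1 g2] := tr (eta * N) (ltW (mulr_gt0 eta0 N0)).
have [k1 k2] := tr (a * N) (ltW (mulr_gt0 a0 N0)).
have hK : (n * K < sig.+1 * L)%N.
  rewrite -(ltr_nat R) !natrM -natr1 -/N.
  move: dN; rewrite ler_pdivrMr // => dN.
  apply: le_lt_trans (_ : N * (a * N) < _); first by rewrite ler_wpM2l // ltW.
  apply: lt_le_trans (_ : (eta * N) * (dl * N / 2) <= _).
    have -> : N * (a * N) = (eta * N) * (dl * N / 4) by rewrite /a; field.
    rewrite ltr_pM2l ?mulr_gt0 //; have := mulr_gt0 dl0 N0; lra.
  apply: ler_pM; rewrite ?mulr_ge0 ?(ltW eta0) ?(ltW N0) ?(ltW dl0) //.
    by move: g2; rewrite -/sig; lra.
  by move: L2; rewrite -/L; lra.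
have hn : (sig + s + L <= n)%N.
  rewrite -(ler_nat R) !natrD; apply: le_trans (lerD (lerD g1 s1) L1) _.
  by rewrite -/N; move: tau16; nra.
have sI : tau * N - 1 <= s%:R <= tau * N by rewrite s1 s2.
have B := supercritical_bound hK hn cN sI L1 g1.
rewrite (Gnp_prob_compl (c / N)) lerD2l lerN2.
apply: (@le_trans _ _ (Gnp_prob (c / N) [pred G : sgraph 'I_n | (treedepth G <= K)%N])).
  apply: Gnp_prob_mono => // G /=; rewrite negb_and -!ltNge mul1r => /orP[h|].
    by rewrite -ltnS -(ltr_nat R); apply: lt_trans h (truncnS_gt _).
  by rewrite ltr_nat ltnNge -[n in (_ <= n)%N]card_ord treedepth_le_card.
apply: le_trans B _; rewrite expRD [leLHS]mulrC /C -[leRHS]mulrA.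
apply: ler_wpM2l; first exact: expR_ge0.
apply: le_trans (expRN_le_inv (mulr_gt0 beta0 N0)) _.
rewrite invfM; apply: ler_wpM2l; first by rewrite invr_ge0 ltW.
by rewrite lef_pV2 ?posrE // (lt_le_trans ltr01).
Qed.

End Supercritical.
End Asymptotics.

(** * Explicit potentials for the upper bounds *)

Section UpperBound.
Local Open Scope ring_scope.
Variable R : realType.
Implicit Types (x y g : R).

Lemma expR_le_inv1B y : y < 1 -> expR y <= (1 - y)^-1.
Proof.
move=> y1; rewrite -[y in leLHS]opprK expRN lef_pV2 ?posrE ?expR_gt0 ?subr_gt0 //.
exact: expR_ge1Dx.
Qed.

(** A rational lower bound for ln (1 + y), which keeps logarithms out of the step conditions on the
    potentials. *)
Lemma expR_frac_le y : 0 <= y -> expR (y / (1 + y)) <= 1 + y.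
Proof.
move=> y0; have y1 : 0 < 1 + y by lra.
apply: le_trans (expR_le_inv1B _) _; first by rewrite ltr_pdivrMr //; lra.
by have -> : 1 - y / (1 + y) = (1 + y)^-1 by [field; rewrite gt_eqF]; rewrite invrK.
Qed.

Lemma pow_le_expR x m : (0 < m)%N -> 0 <= x -> (x / m%:R) ^+ m <= expR x.
Proof.
move=> m0 x0; have m0' : 0 < m%:R :> R by rewrite ltr0n.
have -> : expR x = expR (m%:R * (x / m%:R)) by rewrite mulrC divfK // gt_eqF.
apply: le_expr_expR; first by rewrite divr_ge0 // ltW.
by apply: le_trans (expR_ge1Dx _); rewrite lerDr.
Qed.

(** The unfinished case uses F = exp (h j) with constant G = 1 + th; the closing edges use F = exp
    (phi j) and G = exp (p mu j), which grows just enough to pay 1 + p mu per step. In exponents, th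
    / (1 + th) and g are what the processed vertex pays; [h] and [phi] settle the balance, and [gs]
    is the largest exponent of G. *)
Lemma Gnp_treedepth_gt_exp (n s k r : nat) (c th mu phi : R) (h : nat -> R) :
  let p := c / n%:R in let gs := p * mu * s%:R in
    0 < c -> c <= 1 -> (0 < n)%N -> (s <= n)%N -> (s < 2 ^ k)%N ->
    0 <= th -> 0 <= mu -> 0 <= phi -> h 0%N = 0 -> gs < 1 ->
    (forall j, (j < s)%N -> p * th * (n - s + j)%:R <= h j.+1 - h j + th / (1 + th)) ->
    (forall g, 0 <= g <= gs -> c * g / (1 - gs) <= phi + g) ->
  Gnp_prob p [pred G : sgraph 'I_n | (r + k < treedepth G)%N] <=
  n%:R * (expR (h s) * (1 + th) + expR (phi * s%:R + gs) / (1 + mu) ^+ r.+1).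
Proof.
move=> p gs c0 c1 n0 sn sk th0 mu0 phi0 h0 gs1 hh hphi.
have N0 : 0 < n%:R :> R by rewrite ltr0n.
have N1 : 1 <= n%:R :> R by rewrite ler1n.
have p0 : 0 <= p by rewrite divr_ge0 // ltW.
have p01 : 0 <= p <= 1.
  by rewrite p0 /p ler_pdivrMr // mul1r (le_trans c1).
have nle : (n <= n - s + s)%N by rewrite subnK.
pose exG j := expR (p * mu * j%:R); pose exF j := expR (phi * j%:R).
have pmu0 : 0 <= p * mu by rewrite mulr_ge0.
have G1 j : 1 <= exG j by rewrite -[leLHS]expR0 ler_expR mulr_ge0.
have F1 j : 1 <= exF j by rewrite -[leLHS]expR0 ler_expR mulr_ge0.
have th1 : 1 <= 1 + th by rewrite lerDl.
have al0 j : 0 <= expR (h j) by exact: expR_ge0.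
have h00 : 1 <= expR (h 0%N) by rewrite h0 expR0.
have exGS : forall j, (j < s)%N -> (1 + p * mu) * exG j <= exG j.+1.
  move=> j _; rewrite /exG -natr1 mulrDr mulr1 expRD mulrC.
  by rewrite ler_wpM2l ?expR_ge0 // expR_ge1Dx.
have pn j : (j < s)%N -> p * (n - s + j)%:R <= c.
  move=> js; rewrite /p mulrAC ler_pdivrMr // ler_wpM2l ?(ltW c0) // ler_nat.
  by apply: leq_trans (_ : n - s + s <= n)%N; [rewrite leq_add2l ltnW | rewrite subnK].
apply: le_trans (@Gnp_treedepth_gt R p n p01 s k r (expR \o h) (fun=> 1 + th) exF exG mu (n - s)
  sk nle mu0 (fun=> th1) G1 h00 al0 (fun j _ => lexx _) _ F1 exGS _) _.
- move=> j js /=; rewrite addrAC subrr add0r.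
  apply: le_trans (_ : expR (h j) * expR ((n - s + j)%:R * (p * th)) <= _).
    rewrite ler_wpM2l // le_expr_expR // ?expR_ge1Dx //.
    by rewrite addr_ge0 // mulr_ge0.
  apply: le_trans (_ : expR (h j.+1) * expR (th / (1 + th)) <= _); last first.
    by rewrite ler_wpM2l // expR_frac_le.
  by rewrite -!expRD ler_expR [leLHS]addrC -lerBrDr addrAC mulrC; apply: hh.
- move=> j js; have g0 : 0 <= p * mu * j%:R by rewrite mulr_ge0.
  have gle : p * mu * j%:R <= gs by rewrite /gs ler_wpM2l // ler_nat ltnW.
  apply: le_trans (_ : exF j * expR ((n - s + j)%:R * (p * (exG j - 1))) <= _).
    rewrite ler_wpM2l ?expR_ge0 // le_expr_expR // ?expR_ge1Dx //.
    by rewrite addr_ge0 // mulr_ge0 // subr_ge0.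
  have -> : exF j.+1 = exF j * expR phi by rewrite /exF -natr1 mulrDr mulr1 expRD.
  rewrite -mulrA ler_wpM2l ?expR_ge0 // /exG -expRD ler_expR.
  set g := p * mu * j%:R in g0 gle *.
  have e1 : expR g - 1 <= g / (1 - gs).
    have g1 : g < 1 by apply: le_lt_trans gs1.
    have := expR_le_inv1B g1; have -> : (1 - g)^-1 = 1 + g / (1 - g).
      by field; rewrite gt_eqF // subr_gt0.
    move=> h1; apply: (@le_trans _ _ (g / (1 - g))); first by move: h1; lra.
    by rewrite ler_wpM2l // lef_pV2 ?posrE ?subr_gt0 // lerD2l lerN2.
  apply: le_trans (hphi g _); last by rewrite g0.
  rewrite mulrA [_ * p]mulrC -mulrA; apply: ler_pM => //.
  - by rewrite mulr_ge0.
  - by rewrite subr_ge0 -[leLHS]expR0 ler_expR.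
  exact: pn.
by rewrite /exF /exG -expRD.
Qed.

End UpperBound.

(** * The case c = 1 *)

Section Critical.
Local Open Scope ring_scope.
Variable R : realType.

Lemma ln2_itv : 1 / 2 <= ln (2 : R) <= 1.
Proof.
apply/andP; split.
  rewrite -[leLHS]expRK ler_ln ?posrE ?expR_gt0 //.
  apply: le_trans (expR_le_inv1B _) _; first by lra.
  by have -> : (1 - 1 / 2)^-1 = 2 :> R by field.
rewrite -[leRHS]expRK ler_ln ?posrE ?expR_gt0 //.
by apply: le_trans (expR_ge1Dx _); lra.
Qed.

Lemma cube_between (y : R) : 1 <= y -> exists t : nat, y <= t%:R ^+ 3 <= 8 * y.
Proof.
move=> y1; pose u := expR (ln y / 3); have y0 : 0 < y by apply: lt_le_trans y1.
have u3 : u ^+ 3 = y by rewrite -expR_natM mulrC divfK // lnK.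
have u1 : 1 <= u by rewrite -[leLHS]expR0 ler_expR divr_ge0 // ln_ge0.
exists (Num.truncn u).+1; have h1 := truncnS_gt u.
have h2 : (Num.truncn u).+1%:R <= 2 * u.
  by rewrite -natr1; have := truncn_le u; rewrite (le_trans ler01 u1); lra.
rewrite -{1}u3 -u3 lerXn2r ?nnegrE ?(le_trans ler01 u1) //=; last exact: ltW.
have -> : 8 * u ^+ 3 = (2 * u) ^+ 3 by ring.
by rewrite lerXn2r ?nnegrE // mulr_ge0 // (le_trans ler01 u1).
Qed.

Lemma expR_trunc_log (t : nat) : (0 < t)%N -> (trunc_log 2 t)%:R * ln 2 <= ln (t%:R : R).
Proof.
move=> t0; rewrite -ler_expR expR_natM !lnK ?posrE ?ltr0n // -natrX ler_nat.
exact: trunc_logP.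
Qed.

(** Replacing x by x / (1 + x) loses at most x ^ 2; this is the origin of the term [j%:R * th ^+ 2]
    in the potential of [critical_upper]. *)
Lemma le_sqr_frac (x : R) : 0 <= x -> x <= x ^+ 2 + x / (1 + x).
Proof.
move=> x0; have x1 : 0 < 1 + x by lra.
have -> : x ^+ 2 + x / (1 + x) = x + x ^+ 3 / (1 + x) by field; rewrite gt_eqF.
by rewrite lerDl divr_ge0 ?exprn_ge0 // ltW.
Qed.

(** At c = 1 the first-order terms of the closing-edge potential cancel, and phi = 2 G ^ 2 covers
    the second order. *)
Lemma frac_le_sqr (G g : R) : G <= 1 / 2 -> 0 <= g <= G ->
  1 * g / (1 - G) <= 2 * G ^+ 2 + g.
Proof.
move=> G2 /andP[g0 gG]; have G1 : 0 < 1 - G by lra.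
by rewrite ler_pdivrMr // mul1r; nra.
Qed.

(* The number of steps is of order (n ^ 2 ln n) ^ (1 / 3), which slightly exceeds
   the order n ^ (2 / 3) of the largest critical components. *)
Lemma critical_steps (N : R) : 128 <= ln N ->
  exists2 t : nat, 32 * N ^+ 2 * ln N <= t%:R ^+ 3 <= 256 * N ^+ 2 * ln N
                 & 0 < (t%:R : R) <= N / 2.
Proof.
move=> hX; have N0 : 0 < N.
  by rewrite ltNge; apply: contraTN hX => /ln0 ->; rewrite -ltNge ltr0n.
have X0 : 1 <= ln N by apply: le_trans hX; rewrite ler1n.
have lnN_le : 32 * (64 * ln N) <= N.
  have := @pow_le_expR R (ln N) 4 isT; rewrite lnK // => /(_ (le_trans ler01 X0)).
  have : 32 <= ln N / 4 by rewrite ler_pdivlMr // -natrM.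
  have -> : 64 * ln N = 16 * (16 * (ln N / 4)) by field.
  move: (ln N / 4) => y y32; clear -y32; apply: le_trans.
  have h1 : 16 * y <= y * y by nra.
  have h2 : 16 * (16 * y) <= y ^+ 3.
    by rewrite !exprS expr0 mulr1; apply: ler_pM; lra.
  by rewrite exprS; apply: ler_pM; lra.
have N1 : 1 <= N by lra.
have N2 : 1 <= N ^+ 2 by rewrite exprn_ege1.
have N2X : 1 <= N ^+ 2 * ln N by rewrite mulr_ege1.
have y1 : 1 <= 32 * N ^+ 2 * ln N by rewrite -mulrA; lra.
have [t /andP[t_ge t_le]] := cube_between y1; exists t.
  by rewrite t_ge; have -> : 256 * N ^+ 2 * ln N = 8 * (32 * N ^+ 2 * ln N) by ring.
apply/andP; split.
  by rewrite ltr0n lt0n; apply: contraTneq t_ge => ->; rewrite expr0n /=; lra.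
rewrite -(@ler_pXn2r _ 3) ?nnegrE ?divr_ge0 ?(ltW N0) //; apply: le_trans t_le _.
have -> : (N / 2) ^+ 3 = N ^+ 2 * (N / 8) by field.
have -> : 8 * (32 * N ^+ 2 * ln N) = N ^+ 2 * (32 * (8 * ln N)) by ring.
by rewrite ler_wpM2l ?(le_trans ler01 N2) // ler_pdivlMr //; lra.
Qed.

(** Used with X = ln n and l = ln 2. The constant 87 = 85 + 1 + 1 adds the closing edges, the
    logarithm of the number of steps and rounding. *)
Lemma critical_treedepth_bound (X l : R) (r k d : nat) :
    1 <= X -> 0 < l <= 1 -> r%:R <= 85 * X -> k%:R * l <= X -> (d <= r + k.+1)%N ->
  d%:R <= 87 * (X / l).
Proof.
move=> X1 /andP[l0 l1] hr hk hd; have : (d%:R : R) <= (r + k.+1)%:R by rewrite ler_nat.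
rewrite natrD -natr1 mulrA ler_pdivlMr // => hd'.
have r0 : (0 : R) <= r%:R by [].
apply: le_trans (ler_wpM2r (ltW l0) hd') _.
move: (r%:R : R) (k%:R : R) hr hk r0 => x y hr hk r0; clear -X1 l0 l1 hr hk r0.
have h1 : x * l <= 85 * X by nra.
lra.
Qed.

(** [expR X] is the factor n of the union bound. As ln (1 + 1 / 16) >= 1 / 17 and 85 = 5 * 17, the
    power of 1 + 1 / 16 is at least exp (5 X), which beats exp (X + 2 X + 1). *)
Lemma critical_error (X : R) (r : nat) (A B : R) : 1 <= X -> A <= - (2 * X) ->
    B <= 2 * X + 1 -> 85 * X <= r.+1%:R ->
  expR X * (expR A * 2 + expR B / (1 + 1 / 16) ^+ r.+1) <= 3 / X.
Proof.
move=> X1 hA hB hr; have X0 : 0 < X by lra.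
have p0 : (0 : R) < 1 + 1 / 16 by lra.
have p2 : ((1 + 1 / 16) ^+ r.+1)^-1 <= expR (- (5 * X)).
  rewrite expRN lef_pV2 ?posrE ?expR_gt0 ?exprn_gt0 //.
  have y0 : (0 : R) <= 1 / 16 by lra.
  apply: le_trans (_ : expR (1 / 16 / (1 + 1 / 16)) ^+ r.+1 <= _); last first.
    by rewrite lerXn2r ?nnegrE ?expR_ge0 ?(ltW p0) // expR_frac_le.
  rewrite -expR_natM ler_expR.
  have -> : 1 / 16 / (1 + 1 / 16) = 1 / 17 :> R by field.
  by rewrite mulrA mulr1 ler_pdivlMr //; lra.
have e1 : expR X * expR A <= X^-1.
  by rewrite -expRD; apply: le_trans (expRN_le_inv X0); rewrite ler_expR; lra.
have e2 : expR X * (expR B * expR (- (5 * X))) <= X^-1.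
  by rewrite -!expRD; apply: le_trans (expRN_le_inv X0); rewrite ler_expR; lra.
have e3 : expR X * (expR B / (1 + 1 / 16) ^+ r.+1) <= X^-1.
  by apply: le_trans e2; rewrite !ler_wpM2l ?expR_ge0.
rewrite mulrDr mulrA; move: e1 e3; clear; lra.
Qed.

Lemma critical_upper (n : nat) : let X := ln (n%:R : R) in 128 <= X ->
  Gnp_prob (1 / n%:R) [pred G : sgraph 'I_n | 87 * log2 (n%:R : R) < (treedepth G)%:R] <= 3 / X.
Proof.
move=> X hX; set N : R := n%:R.
have N0 : 0 < N by rewrite ltNge; apply: contraTN hX => /ln0; rewrite /X => ->; rewrite -ltNge ltr0n.
have n0 : (0 < n)%N by rewrite -(ltr0n R).
have eX : expR X = N by rewrite lnK.
have X1 : 1 <= X by apply: le_trans hX; rewrite ler1n.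
have N1 : 1 <= N by rewrite ler1n.
have [t /andP[t_ge t_le] /andP[t0' t_half]] := critical_steps hX.
have t0 : (0 < t)%N by rewrite -(ltr0n R).
have tn : (t <= n)%N.
  rewrite -(ler_nat R) -/N; apply: le_trans t_half _.
  by rewrite ler_pdivrMr // ler_peMr ?(ltW N0) // ler1n.
clear hX.
pose th : R := t%:R / (4 * N); pose r := Num.truncn (85 * X); pose k := trunc_log 2 t.
have th0 : 0 <= th by rewrite divr_ge0 // mulr_ge0 // ltW.
(* h t is about t th ^ 2 - th t ^ 2 / (2 n), and th = t / (4 n) makes it at most
   - t ^ 3 / (16 n ^ 2). *)
pose h (j : nat) := j%:R * th ^+ 2 - th * (j%:R * t%:R - j%:R * (j%:R - 1) / 2) / N.
(* The choice mu = 1 / 16 gives 2 g ^ 2 t = t ^ 3 / (128 n ^ 2), at most 2 X by the upper bound on t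
   ^ 3. *)
pose g := 1 / N * (1 / 16) * t%:R; have gE : g = t%:R / N / 16.
  by rewrite /g mulrAC mul1r [X in X * _]mulrC mulrA mulr1.
have g12 : g <= 1 / 2.
  have : t%:R / N <= 1 / 2 by rewrite ler_pdivrMr // mulrC mul1r.
  by rewrite gE; clear; lra.
have mu0 : (0 : R) <= 1 / 16 by rewrite divr_ge0.
apply: le_trans (Gnp_prob_mono (B := [pred G : sgraph 'I_n | (r + k.+1 < treedepth G)%N]) _ _) _.
- by rewrite divr_ge0 ?(ltW N0) // ler_pdivrMr // mul1r.
- move=> G /=; rewrite ltNge ltnNge; apply: contra => hd.
  apply: (@critical_treedepth_bound _ _ r k) => //.
  + by have /andP[l1 ->] := ln2_itv; rewrite andbT (lt_le_trans _ l1) // divr_gt0.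
  + by rewrite truncn_le // mulr_ge0 // (le_trans ler01).
  apply: le_trans (expR_trunc_log t0) _; rewrite ler_ln ?posrE ?ltr0n // ler_nat //.
have g0 : 0 <= g by rewrite gE !divr_ge0 // ltW.
have phi0 : 0 <= 2 * g ^+ 2 by rewrite mulr_ge0 // exprn_ge0.
have h0 : h 0%N = 0 by rewrite /h !mul0r subrr mulr0 mul0r subr0.
have gs1 : g < 1 by apply: le_lt_trans g12 _; rewrite ltr_pdivrMr // mul1r ltr1n.
have hstep j : (j < t)%N -> 1 / N * th * (n - t + j)%:R <= h j.+1 - h j + th / (1 + th).
  move=> jt; have -> : h j.+1 - h j = th ^+ 2 - th * (t%:R - j%:R) / N.
    by rewrite /h -natr1; field; rewrite gt_eqF.
  rewrite natrD natrB // -/N.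
  have -> : 1 / N * th * (N - t%:R + j%:R) = th - th * (t%:R - j%:R) / N by field; rewrite gt_eqF.
  by rewrite addrAC lerD2r le_sqr_frac.
have := @Gnp_treedepth_gt_exp R n t k.+1 r 1 th (1 / 16) (2 * g ^+ 2) h ltr01 (lexx 1) n0 tn.
rewrite -/N -/g => bound; apply: le_trans (bound _ th0 mu0 phi0 h0 gs1 hstep _) _.
- exact: trunc_log_ltn.
- by move=> g'; apply: frac_le_sqr.
apply: le_trans (_ : expR X * (expR (h t) * 2 + expR (2 * g ^+ 2 * t%:R + g) / (1 + 1 / 16) ^+ r.+1) <= _).
  rewrite eX ler_wpM2l ?(ltW N0) // lerD2r ler_wpM2l ?expR_ge0 // lerD2l.
  rewrite ler_pdivrMr ?mulr_gt0 // mul1r; apply: le_trans t_half _.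
  by rewrite ler_pdivrMr // -mulrA mulrCA ler_peMr ?(ltW N0) // -natrM ler1n.
apply: critical_error => //.
- have -> : h t = - (t%:R ^+ 3 / (16 * N ^+ 2)) - th * t%:R / (2 * N).
    by rewrite /h /th; field; rewrite gt_eqF.
  have : 2 * X <= t%:R ^+ 3 / (16 * N ^+ 2).
    rewrite ler_pdivlMr ?mulr_gt0 ?exprn_gt0 //; apply: le_trans t_ge.
    by rewrite le_eqVlt; apply/orP; left; apply/eqP; rewrite -/X; ring.
  have : 0 <= th * t%:R / (2 * N) by apply: divr_ge0; apply: mulr_ge0 => //; apply: ltW.
  by clear; move=> h1 h2; lra.
- apply: lerD; last by apply: ltW.
  have -> : 2 * g ^+ 2 * t%:R = t%:R ^+ 3 / (128 * N ^+ 2) by rewrite gE; field; rewrite gt_eqF.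
  rewrite ler_pdivrMr ?mulr_gt0 ?exprn_gt0 //; apply: le_trans t_le _.
  by rewrite le_eqVlt; apply/orP; left; apply/eqP; rewrite -/X; ring.
by apply/ltW/truncnS_gt.
Qed.
End Critical.

Section CriticalWindow.
Local Open Scope ring_scope.
Variable R : realType.

(** Rounding y down to k loses nothing, because k < 2 ^ d already gives k + 1 <= 2 ^ d. *)
Lemma ltn_pow_ln (y : R) (k d : nat) : 0 < y -> y < k.+1%:R -> (k < 2 ^ d)%N ->
  ln y <= d%:R * ln 2.
Proof.
move=> y0 yk kd; rewrite -ler_expR expR_natM !lnK ?posrE //.
by apply: le_trans (ltW yk) _; rewrite -natrX ler_nat.
Qed.

(** With about n ^ (1 / 4) vertices on the path, the second moment error 18 k ^ 3 / n is at most 18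
    n ^ (- 1 / 4), and n ^ (1 / 4) >= X / 4 gives 72 / X. *)
Lemma critical_lower (n : nat) : let X := ln (n%:R : R) in 128 <= X ->
  Gnp_prob (1 / n%:R) [pred G : sgraph 'I_n | (treedepth G)%:R < 1 / 4 * log2 (n%:R : R)] <= 72 / X.
Proof.
move=> X hX; set N : R := n%:R.
have X16 : 16 <= X by apply: le_trans hX; rewrite ler_nat.
have N0 : 0 < N by rewrite ltNge; apply: contraTN X16 => /ln0; rewrite /X => ->; rewrite -ltNge ltr0n.
have n0 : (0 < n)%N by rewrite -(ltr0n R).
have N1 : 1 <= N by rewrite ler1n.
have X0 : 0 < X by apply: lt_le_trans X16.
pose u := expR (X / 4); have u4 : u ^+ 4 = N by rewrite -expR_natM mulrC divfK // lnK.
have u0 : 0 < u by apply: expR_gt0.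
have uX : 1 + X / 4 <= u by apply: expR_ge1Dx.
have [k hk] : exists k', Num.truncn u = k'.+1.
  exists (Num.truncn u).-1; rewrite prednK // truncn_gt0.
  by move: uX X16; clear; lra.
have ku : k.+1%:R <= u by rewrite -hk truncn_le // ltW.
have uk : u < k.+2%:R by rewrite -hk truncnS_gt.
have k4 : (4 <= k.+1)%N.
  rewrite -ltnS -(ltr_nat R); apply: le_lt_trans uk.
  by move: uX X16; clear; lra.
have k4n : (k.+1 ^ 4 <= n)%N.
  by rewrite -(ler_nat R) natrX -/N -u4 lerXn2r // nnegrE ltW.
have k3 : (4 * k.+1 ^ 3 <= n)%N by apply: leq_trans k4n; rewrite [(_ ^ 4)%N]expnS leq_mul2r k4 orbT.
have k2 : (2 * k.+1 ^ 2 <= n)%N.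
  by apply: leq_trans k3; rewrite [(_ ^ 3)%N]expnS mulnA leq_mul2r -[2%N]muln1 leq_mul ?orbT.
have p0 : 0 < 1 / N by rewrite divr_gt0.
have p1 : 1 / N <= 1 by rewrite ler_pdivrMr // mul1r.
have c1 : n%:R * (1 / N) = 1 by rewrite mul1r mulfV // gt_eqF.
have := Gnp_short_paths p0 p1; move=> /(_ n k); rewrite c1 => /(_ (lexx 1) k3 k2) B.
apply: le_trans (Gnp_prob_mono (B := [pred G : sgraph 'I_n | (2 ^ treedepth G <= k.+1)%N]) _ _) _.
- by rewrite (ltW p0).
- move=> G /=; rewrite ltNge leqNgt; apply: contra => kd.
  have := ltn_pow_ln u0 uk kd; rewrite expRK => h.
  rewrite /log2 mulrA ler_pdivrMr; last by have /andP[l1 _] := ln2_itv R; apply: lt_le_trans l1; rewrite divr_gt0.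
  by apply: le_trans h; rewrite mulrC mulrA mulr1.
apply: le_trans B _; rewrite expr1n mul1r -/N natrM natrX.
rewrite ler_pdivrMr // mulrAC ler_pdivlMr // -u4.
have h3 : k.+1%:R ^+ 3 <= u ^+ 3 by rewrite lerXn2r // nnegrE ltW.
have hu : 18 * X <= 72 * u by move: uX; clear; lra.
rewrite mulrAC [u ^+ 4]exprS [72 * _]mulrA; apply: ler_pM; rewrite ?exprn_ge0 //.
by apply: mulr_ge0 => //; apply: ltW.
Qed.

Lemma critical_aas : aas_treedepth_Theta (fun n => 1 / n%:R) (fun n => log2 (n%:R : R)).
Proof.
apply: (@aas_treedepth_rate _ _ _ (1 / 4) 87 75 128) => [||n hX].
- by rewrite divr_gt0.
- by rewrite ler_pdivrMr // -natrM ler1n.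
have N1 : 1 <= n%:R :> R.
  rewrite ler1n lt0n; apply: contraTneq hX => ->; rewrite ln0 // -ltNge ltr0n //.
have N0 : 0 < n%:R :> R by apply: lt_le_trans N1.
have p01 : 0 <= 1 / (n%:R : R) <= 1 by rewrite divr_ge0 ?(ltW N0) // ler_pdivrMr // mul1r.
split=> //; pose B1 := [pred G : sgraph 'I_n | (treedepth G)%:R < 1 / 4 * log2 (n%:R : R)].
pose B2 := [pred G : sgraph 'I_n | 87 * log2 (n%:R : R) < (treedepth G)%:R].
apply: le_trans (Gnp_prob_union (B1 := B1) (B2 := B2) p01 _); last first.
  by move=> G /=; rewrite negb_and -!ltNge.
rewrite lerD2l lerN2; apply: le_trans (lerD (critical_lower hX) (critical_upper hX)) _.
by rewrite -mulrDl -natrD.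
Qed.
End CriticalWindow.

(** * The case c < 1 *)

Section Subcritical.
Local Open Scope ring_scope.
Variables (R : realType) (c : R).
Hypotheses (c0 : 0 < c) (c1 : c < 1).

(** [eps] is such that c ^ (eps ln n) = n ^ (- 1 / 2), so paths on eps ln n vertices are still
    expected in large number. [th] satisfies th / (1 + th) = (1 - c) / 2, whence c th - th / (1 +
    th) = - kap and the potential decays by exp (- kap) per step. In D = 3 / kap, 2 / kap brings the
    decay to n ^ (- 2) and 1 / kap absorbs rounding. *)
Let lam := - ln c.
Let eps := 1 / (2 * lam).
Let th := (1 - c) / (1 + c).
Let kap := th * (1 - c) / 2.
Let D := 3 / kap.

Let lam0 : 0 < lam. Proof. by rewrite /lam oppr_gt0 ln_lt0 // c0. Qed.
Let eps0 : 0 < eps. Proof. by rewrite /eps divr_gt0 // mulr_gt0. Qed.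
Let th0 : 0 < th. Proof. by rewrite /th divr_gt0; move: c0 c1; lra. Qed.
Let kap0 : 0 < kap. Proof. by rewrite /kap divr_gt0 // mulr_gt0 // subr_gt0. Qed.
Let D0 : 0 < D. Proof. by rewrite /D divr_gt0. Qed.

Let l2_0 : 0 < ln (2 : R).
Proof. by have /andP[l1 _] := ln2_itv R; apply: lt_le_trans l1; rewrite divr_gt0. Qed.

(** The factor 1 / 2 absorbs constants: [y] is proportional to X in the application, so y ^ 2
    eventually exceeds 2 X >= X / ln 2. *)
Let log2_sqr (X y : R) (d : nat) : 0 < X -> 0 < y -> ln y <= d%:R * ln 2 ->
  2 * X <= y ^+ 2 -> 1 / 2 * log2 (X / ln 2) <= d%:R.
Proof.
move=> X0 y0 hy hX; have /andP[l1 _] := ln2_itv R.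
rewrite /log2 mulrA ler_pdivrMr //; apply: le_trans hy.
rewrite -ler_pdivlMl ?divr_gt0 //; have -> : (1 / 2)^-1 * ln y = ln (y ^+ 2).
  have -> : (1 / 2)^-1 = 2 :> R by field.
  by rewrite lnXn // mulr_natl.
rewrite ler_ln ?posrE ?divr_gt0 ?exprn_gt0 //; apply: le_trans hX.
by rewrite ler_pdivrMr // mulrAC; move: X0 l1; move: (ln 2) => z; nra.
Qed.

Lemma subcritical_lower (n : nat) : let X := ln (n%:R : R) in
    Num.max 1 (Num.max (2 * lam) (Num.max (32 * (32 * eps ^+ 3)) (2 / eps ^+ 2))) <= X ->
  Gnp_prob (c / n%:R) [pred G : sgraph 'I_n |
    (treedepth G)%:R < 1 / 2 * log2 (log2 (n%:R : R))] <= 18 * 8 ^+ 4 * eps ^+ 3 / X.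
Proof.
move=> X; rewrite !ge_max => /and4P[X1 Xlam Xeps3 Xeps2]; set N : R := n%:R.
have N0 : 0 < N by rewrite ltNge; apply: contraTN X1 => /ln0; rewrite /X => ->; rewrite -ltNge ltr01.
have n0 : (0 < n)%N by rewrite -(ltr0n R).
have N1 : 1 <= N by rewrite ler1n.
have X0 : 0 < X by apply: lt_le_trans X1.
have eX : expR X = N by rewrite lnK.
have eX0 : 0 < eps * X by rewrite mulr_gt0.
have epsX : 1 <= eps * X by rewrite /eps mulrAC mul1r ler_pdivlMr ?mulr_gt0 // mul1r.
have [k hk] : exists k', Num.truncn (eps * X) = k'.+1.
  by exists (Num.truncn (eps * X)).-1; rewrite prednK // truncn_gt0.
have ku : k.+1%:R <= eps * X by rewrite -hk truncn_le // ltW.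
have uk : eps * X < k.+2%:R by rewrite -hk truncnS_gt.
have kX3 : k.+1%:R ^+ 3 <= (eps * X) ^+ 3 by rewrite lerXn2r // nnegrE ltW.
have k3 : (4 * k.+1 ^ 3 <= n)%N.
  rewrite -(ler_nat R) natrM natrX -/N -eX.
  apply: le_trans (pow_le_expR (isT : (0 < 4)%N) (ltW X0)).
  apply: le_trans (_ : 4 * (eps * X) ^+ 3 <= _); first by rewrite ler_wpM2l.
  have -> : (X / 4) ^+ 4 = X / (16 * 16) * X ^+ 3 by field.
  have -> : 4 * (eps * X) ^+ 3 = (4 * eps ^+ 3) * X ^+ 3 by ring.
  rewrite ler_wpM2r ?exprn_ge0 ?(ltW X0) // ler_pdivlMr; last by rewrite mulr_gt0.
  by apply: le_trans Xeps3; rewrite le_eqVlt; apply/orP; left; apply/eqP; ring.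
have k2 : (2 * k.+1 ^ 2 <= n)%N.
  by apply: leq_trans k3; rewrite [(_ ^ 3)%N]expnS mulnA leq_mul2r -[2%N]muln1 leq_mul ?orbT.
have p0 : 0 < c / N by rewrite divr_gt0.
have p1 : c / N <= 1 by rewrite ler_pdivrMr // mul1r (le_trans (ltW c1)).
have cE : n%:R * (c / N) = c by rewrite mulrC divfK // gt_eqF.
have := Gnp_short_paths p0 p1; move=> /(_ n k); rewrite cE => /(_ (ltW c1) k3 k2) B.
apply: le_trans (Gnp_prob_mono (B := [pred G : sgraph 'I_n | (2 ^ treedepth G <= k.+1)%N]) _ _) _.
- by rewrite (ltW p0).
- move=> G /=; rewrite ltNge leqNgt; apply: contra => kd.
  apply: (log2_sqr X0 eX0 (ltn_pow_ln eX0 uk kd)).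
  have -> : (eps * X) ^+ 2 = eps ^+ 2 * X * X by ring.
  by rewrite ler_wpM2r ?(ltW X0) //; move: Xeps2; rewrite ler_pdivrMr ?exprn_gt0 // mulrC.
apply: le_trans B _; rewrite -/N natrM natrX.
have ck : expR (- (X / 2)) <= c ^+ k.
  rewrite expr_ln // ler_expR lerNl -mulrN -/lam.
  apply: le_trans (_ : eps * X * lam <= _).
    rewrite ler_wpM2r ?(ltW lam0) //; apply: le_trans ku; by rewrite ler_nat.
  by rewrite le_eqVlt; apply/orP; left; apply/eqP; rewrite /eps; field; rewrite gt_eqF.
(* The right side is at least the square root of n. A fourth power of X suffices, since the cube of
   the path length divided by it is of order 1 / X. *)
have den : (X / 8) ^+ 4 <= c ^+ k * N.
  apply: le_trans (_ : expR (X / 2) <= _).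
    have -> : X / 8 = X / 2 / 4 by field.
    by apply: (@pow_le_expR _ _ 4) => //; rewrite divr_ge0 // ltW.
  rewrite -eX; apply: le_trans (_ : expR (- (X / 2)) * expR X <= _).
    by rewrite -expRD ler_expR; lra.
  by rewrite ler_wpM2r // expR_ge0.
have d0 : 0 < (X / 8) ^+ 4 by rewrite exprn_gt0 // divr_gt0.
apply: le_trans (_ : 18 * (eps * X) ^+ 3 / (X / 8) ^+ 4 <= _).
  apply: ler_pM; rewrite ?invr_ge0 ?mulr_ge0 ?exprn_ge0 ?(ltW c0) ?(ltW N0) //.
    by rewrite ler_wpM2l.
  by rewrite lef_pV2 // posrE (lt_le_trans d0).
by rewrite le_eqVlt; apply/orP; left; apply/eqP; field; rewrite gt_eqF.
Qed.

(** [mu] is chosen with p mu t = 1 - c, so that c g / (1 - gs) = g and phi = 0 works. Then mu is at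
    least of order n / ln n, and a second closing edge somewhere has probability O((ln n) ^ 2 /
    n). *)
Lemma subcritical_upper (n : nat) : let X := ln (n%:R : R) in
    Num.max 1 (Num.max kap (4 * D)) <= X ->
  Gnp_prob (c / n%:R) [pred G : sgraph 'I_n |
    2 * log2 (log2 (n%:R : R)) < (treedepth G)%:R] <=
  (2 + expR 1 * (c * D / (1 - c)) ^+ 2 * 27) / X.
Proof.
move=> X; rewrite !ge_max => /and3P[X1 Xkap XD]; set N : R := n%:R.
have N0 : 0 < N by rewrite ltNge; apply: contraTN X1 => /ln0; rewrite /X => ->; rewrite -ltNge ltr01.
have n0 : (0 < n)%N by rewrite -(ltr0n R).
have N1 : 1 <= N by rewrite ler1n.
have X0 : 0 < X by apply: lt_le_trans X1.
have eX : expR X = N by rewrite lnK.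
have /andP[l1 l2] := ln2_itv R.
pose t := (Num.truncn (2 * X / kap)).+1.
have Xk0 : 0 < 2 * X / kap by rewrite divr_gt0 // mulr_gt0.
have t_ge : 2 * X <= kap * t%:R.
  by rewrite [leRHS]mulrC -ler_pdivrMr //; apply/ltW/truncnS_gt.
have t_le : t%:R <= D * X.
  rewrite /t -natr1; apply: le_trans (_ : 2 * X / kap + X / kap <= _).
    by apply: lerD; [rewrite truncn_le // ltW | rewrite ler_pdivlMr // mul1r].
  by rewrite le_eqVlt; apply/orP; left; apply/eqP; rewrite /D; field; rewrite gt_eqF.
have t0 : 0 < t%:R :> R by rewrite ltr0n.
have DX2 : 4 * (D * X) <= X ^+ 2 by rewrite mulrA expr2 ler_wpM2r // ltW.
have DXN : D * X <= N.
  apply: le_trans (_ : (X / 2) ^+ 2 <= _).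
    by rewrite expr_div_n ler_pdivlMr ?exprn_gt0 //; move: DX2; lra.
  by rewrite -eX; apply: (@pow_le_expR _ _ 2) => //; apply: ltW.
have tn : (t <= n)%N by rewrite -(ler_nat R); apply: le_trans t_le DXN.
pose mu := (1 - c) * N / (c * t%:R); pose k := trunc_log 2 t.
have ct0 : 0 < c * t%:R by rewrite mulr_gt0.
have c10 : 0 < 1 - c by rewrite subr_gt0.
have mu0 : 0 < mu by rewrite /mu divr_gt0 // mulr_gt0.
have gsE : c / N * mu * t%:R = 1 - c by rewrite /mu; field; rewrite !gt_eqF.
apply: le_trans (Gnp_prob_mono (B := [pred G : sgraph 'I_n | (1 + k.+1 < treedepth G)%N]) _ _) _.
- by rewrite divr_ge0 ?(ltW c0) ?(ltW N0) // ler_pdivrMr // mul1r (le_trans (ltW c1)).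
- move=> G /=; rewrite ltNge ltnNge; apply: contra => hd.
  rewrite /log2 mulrA ler_pdivlMr //.
  (* The bound 2 + k is at most the binary logarithm of 4 t, and 4 t <= 4 D X <= X ^ 2 turns all
     constants into the factor 2. *)
  apply: le_trans (_ : (2 + k)%:R * ln 2 <= _); first by rewrite ler_wpM2r ?(ltW l2_0) // ler_nat.
  rewrite natrD mulrDl; apply: le_trans (lerD (lexx _) (expR_trunc_log R (isT : (0 < t)%N))) _.
  have -> : 2 * ln (2 : R) = ln (2 ^+ 2) by rewrite lnXn // mulr_natl.
  have -> : 2 * ln (ln N / ln 2) = ln ((X / ln 2) ^+ 2) by rewrite lnXn ?divr_gt0 // mulr_natl.
  have q0 := exprn_gt0 2 (divr_gt0 X0 l2_0).
  have t4 : 0 < 2 ^+ 2 * t%:R :> R by apply: mulr_gt0 => //; apply: exprn_gt0.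
  rewrite -lnM ?posrE ?exprn_gt0 // ler_ln ?posrE //.
  apply: le_trans (_ : X ^+ 2 <= _).
    apply: le_trans DX2; have -> : 2 ^+ 2 = 4 :> R by ring.
    by rewrite ler_wpM2l.
  rewrite lerXn2r ?nnegrE ?divr_ge0 ?(ltW X0) ?(ltW l2_0) // ler_pdivlMr //.
  by rewrite ler_piMr // ltW.
have h0 : (fun j : nat => - (kap * j%:R)) 0%N = 0 by rewrite mulr0 oppr0.
have gs1 : c / N * mu * t%:R < 1 by rewrite gsE; move: c0; lra.
have hstep j : (j < t)%N -> c / N * th * (n - t + j)%:R <=
    - (kap * j.+1%:R) - - (kap * j%:R) + th / (1 + th).
  move=> jt; have -> : - (kap * j.+1%:R) - - (kap * j%:R) + th / (1 + th) = c * th.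
    rewrite -natr1 /kap /th; field; apply/andP; split; rewrite gt_eqF //; move: c0; lra.
  apply: le_trans (_ : c / N * th * N <= _).
    have cth0 : 0 <= c / N * th by apply: mulr_ge0; [apply: divr_ge0|]; apply: ltW.
    apply: ler_wpM2l => //; rewrite /N ler_nat.
    by apply: leq_trans (_ : n - t + t <= n)%N; [rewrite leq_add2l ltnW | rewrite subnK].
  by rewrite le_eqVlt; apply/orP; left; apply/eqP; field; rewrite gt_eqF.
have := @Gnp_treedepth_gt_exp R n t k.+1 1 c th mu 0 (fun j => - (kap * j%:R))
  c0 (ltW c1) n0 tn (trunc_log_ltn t (isT : (1 < 2)%N)) (ltW th0) (ltW mu0) (lexx 0) h0.
rewrite -/N => bound; apply: le_trans (bound gs1 hstep _) _.
  move=> g _; rewrite gsE opprB addrCA subrr addr0 add0r mulrAC mulfV ?mul1r //.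
  by rewrite gt_eqF.
rewrite gsE mul0r add0r -/N.
have e1 : N * (expR (- (kap * t%:R)) * (1 + th)) <= 2 / X.
  have th1 : 1 + th <= 2.
    by rewrite -[X in _ <= X]/(1 + 1) lerD2l /th ler_pdivrMr; move: c0; lra.
  have e0 : N * expR (- (kap * t%:R)) <= X^-1.
    rewrite -eX -expRD; apply: le_trans (expRN_le_inv X0); rewrite ler_expR.
    by move: t_ge; move: (kap * t%:R) => z; lra.
  rewrite mulrA [leLHS]mulrC; apply: ler_pM th1 e0; first by rewrite addr_ge0 // ltW.
  by rewrite mulr_ge0 ?expR_ge0 // ltW.
have e2 : N * (expR (1 - c) / (1 + mu) ^+ 2) <= expR 1 * (c * D / (1 - c)) ^+ 2 * 27 / X.
  have m2 : (mu ^+ 2)^-1 <= (c * D / (1 - c)) ^+ 2 * X ^+ 2 / N ^+ 2.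
    have -> : (mu ^+ 2)^-1 = (c * t%:R / (1 - c)) ^+ 2 / N ^+ 2.
      by rewrite /mu; field; rewrite !gt_eqF.
    rewrite ler_wpM2r ?invr_ge0 ?exprn_ge0 ?(ltW N0) // -exprMn lerXn2r ?nnegrE //.
    - by rewrite divr_ge0 ?(ltW ct0) ?(ltW c10).
    - by rewrite ltW // mulr_gt0 // divr_gt0 // mulr_gt0.
    by rewrite [leRHS]mulrAC -[c * D * X]mulrA ler_wpM2r ?invr_ge0 ?(ltW c10) // ler_wpM2l // ltW.
  have mu2 : ((1 + mu) ^+ 2)^-1 <= (mu ^+ 2)^-1.
    by rewrite lef_pV2 ?posrE ?exprn_gt0 ?addr_gt0 // lerXn2r ?nnegrE ?addr_ge0 ?(ltW mu0) // lerDr.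
  have XN : X ^+ 2 / N <= 27 / X.
    rewrite ler_pdivrMr // mulrAC ler_pdivlMr // -exprSr.
    have := @pow_le_expR _ X 3 isT (ltW X0); rewrite eX expr_div_n ler_pdivrMr ?exprn_gt0 //.
    by have -> : 3 ^+ 3 = 27 :> R by [ring]; rewrite mulrC.
  apply: le_trans (_ : N * (expR 1 * ((c * D / (1 - c)) ^+ 2 * X ^+ 2 / N ^+ 2)) <= _).
    rewrite ler_wpM2l ?(ltW N0) //; apply: ler_pM; rewrite ?expR_ge0 ?invr_ge0 ?exprn_ge0 ?addr_ge0 ?(ltW mu0) //.
      by rewrite ler_expR; move: c0; lra.
    exact: le_trans mu2 m2.
  have -> : N * (expR 1 * ((c * D / (1 - c)) ^+ 2 * X ^+ 2 / N ^+ 2)) =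
      expR 1 * (c * D / (1 - c)) ^+ 2 * (X ^+ 2 / N) by field; rewrite !gt_eqF.
  rewrite -[leRHS]mulrA ler_wpM2l // mulr_ge0 ?expR_ge0 ?exprn_even_ge0 //.
by rewrite mulrDr [leRHS]mulrDl; apply: lerD.
Qed.

Lemma subcritical_aas :
  aas_treedepth_Theta (fun n => c / n%:R) (fun n => log2 (log2 (n%:R : R))).
Proof.
pose X1 := Num.max 1 (Num.max (2 * lam) (Num.max (32 * (32 * eps ^+ 3)) (2 / eps ^+ 2))).
pose X2 := Num.max 1 (Num.max kap (4 * D)).
pose C1 := 18 * 8 ^+ 4 * eps ^+ 3.
pose C2 := 2 + expR 1 * (c * D / (1 - c)) ^+ 2 * 27.
apply: (@aas_treedepth_rate _ _ _ (1 / 2) 2 (C1 + C2) (Num.max X1 X2)) => [||n].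
- by rewrite divr_gt0.
- by rewrite ler_pdivrMr // -natrM ler1n.
rewrite ge_max => /andP[hX1 hX2].
have N1 : 1 <= n%:R :> R.
  move: hX1; rewrite ge_max => /andP[hX _].
  by rewrite ler1n lt0n; apply: contraTneq hX => ->; rewrite ln0 // -ltNge ltr01.
have N0 : 0 < n%:R :> R by apply: lt_le_trans N1.
have p01 : 0 <= c / n%:R <= 1.
  by rewrite divr_ge0 ?(ltW N0) ?(ltW c0) // ler_pdivrMr // mul1r (le_trans (ltW c1)).
split=> //.
pose B1 := [pred G : sgraph 'I_n | (treedepth G)%:R < 1 / 2 * log2 (log2 (n%:R : R))].
pose B2 := [pred G : sgraph 'I_n | 2 * log2 (log2 (n%:R : R)) < (treedepth G)%:R].
apply: le_trans (Gnp_prob_union (B1 := B1) (B2 := B2) p01 _); last first.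
  by move=> G /=; rewrite negb_and -!ltNge.
rewrite lerD2l lerN2 [leRHS]mulrDl.
exact: lerD (subcritical_lower hX1) (subcritical_upper hX2).
Qed.
End Subcritical.

Local Open Scope ring_scope.

Theorem theorem1p2 (R : realType) (c : R) (hc : 0 < c) :
  [/\ c < 1 ->
        aas_treedepth_Theta (fun n => c / n%:R) (fun n => log2 (log2 n%:R)),
      c = 1 ->
        aas_treedepth_Theta (fun n => c / n%:R) (fun n => log2 n%:R)
    & 1 < c ->
        aas_treedepth_Theta (fun n => c / n%:R) (fun n => n%:R)].
Proof.
split; [exact: subcritical_aas | | exact: supercritical_aas].
by move=> ->; exact: critical_aas.
Qed.
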